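(* Let $\epsilon\in(0,1/30]$ and let $y$ be the output of the covering procedure described in the context. Then $y\ge 0$ and $A^Ty\ge\mathbf 1$ always hold, and there is an absolute constant $C>0$ such that with probability at least $9/10$, $\mathbf 1^Ty\le (1+C\epsilon)\,\mathrm{OPT}$. The procedure runs Algorithm 1 for $T=O\!\left(\frac{\log^2(1/\epsilon)\log(nm/\epsilon)\log(2n)}{\epsilon^2}\right)$ iterations.
   Context: Standing setup: $A\in\mathbb{R}^{m\times n}_{\ge 0}$ has no zero column and is normalized so that $\min_{i\in[n]}\|A_{:i}\|_\infty=1$, where $A_{:i}$ denotes the $i$-th column. The packing LP is $\max\{\mathbf 1^Tx: x\ge 0,\ Ax\le \mathbf 1\}$ with optimal value $\mathrm{OPT}$, which equals the optimal value of the covering LP $\min\{\mathbf 1^Ty: y\ge 0,\ A^Ty\ge \mathbf 1\}$. $\log$ is the natural logarithm unless written $\log_2$. $\mu=\frac{\epsilon}{4\log(nm/\epsilon)}$, $p_j(x)=\exp\big(\frac{1}{\mu}((Ax)_j-1)\big)$, $p(x)=(p_1(x),\dots,p_m(x))$, $f_\mu(x)=-\mathbf 1^Tx+\mu\sum_j p_j(x)$, with $\nabla_i f_\mu(x)=-1+\sum_j A_{ji}p_j(x)$. Algorithm 1 with $T$ iterations: set $\alpha=\mu/20$, $w=\lceil\log_2(1/\epsilon)\rceil$, $x_0[i]=\frac{1-\epsilon/2}{n\|A_{:i}\|_\infty}$. For $k=0,\dots,T-1$: choose $t_k\in\{0,\dots,w-1\}$ uniformly at random, independently of the past; writing $g_i=\nabla_i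 f_\mu(x_k)$, define $\xi_k[i]=0$ if $|g_i|\le\epsilon$, $\xi_k[i]=g_i$ if $\epsilon<|g_i|\le 1$, $\xi_k[i]=1$ if $g_i>1$; $\xi^{(t)}_k[i]=\xi_k[i]$ if $\epsilon2^t<|\xi_k[i]|\le\epsilon2^{t+1}$ and $0$ otherwise; $x_{k+1}[i]=x_k[i]\exp(-\alpha\,\xi^{(t_k)}_k[i])$. Covering procedure: run Algorithm 1 for $T=\big\lceil\max\{\frac{6w\log(2n)}{\alpha\epsilon},\frac{2w^2\log(n/\epsilon)}{\epsilon^2}\}\big\rceil$ iterations; let $\bar y=\frac1T\sum_{k=0}^{T-1}p(x_k)$. Algorithm 2: set $\bar y'=\bar y$; for every $i\in[n]$ with $\lambda_i:=(A^T\bar y)_i-1+\epsilon\le -2\epsilon$, pick $j$ with $A_{j,i}=\|A_{:i}\|_\infty$ and increase $\bar y'_j$ by $-\lambda_i/A_{j,i}$. Output $y=\bar y'/(1-3\epsilon)$. *)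

(* Defs.v *)
From Stdlib Require Import Reals Lra Lia List.
Import ListNotations.
Open Scope R_scope.

Fixpoint sumn (f : nat -> R) (k : nat) : R :=
  match k with O => 0 | S k' => sumn f k' + f k' end.

Definition ceilZ (x : R) : Z :=
  if Req_EM_T (IZR (up x) - 1) x then (up x - 1)%Z else up x.
Definition ceil_nat (x : R) : nat := Z.to_nat (ceilZ x).

Definition log2 (x : R) : R := ln x / ln 2.

Section Alg.
(* A : m x n matrix, entry A j i with row j < m, column i < n *)
Variables (m n : nat) (A : nat -> nat -> R) (eps : R).

(* ||A_{:i}||_inf for a nonnegative matrix *)
Definition colmax (i : nat) : R :=
  fold_right Rmax 0 (map (fun j => A j i) (seq 0 m)).

Definition Ax (x : nat -> R) (j : nat) : R := sumn (fun i => A j i * x i) n.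

Definition mu : R := eps / (4 * ln (INR n * INR m / eps)).
Definition alpha : R := mu / 20.
Definition wpar : nat := ceil_nat (log2 (1 / eps)).

Definition pj (x : nat -> R) (j : nat) : R := exp ((Ax x j - 1) / mu).

Definition grad (x : nat -> R) (i : nat) : R :=
  -1 + sumn (fun j => A j i * pj x j) m.

(* xi_k[i] as a function of g = grad_i f_mu(x_k).  (g < -1 never occurs.) *)
Definition xi (g : R) : R :=
  if Rle_dec (Rabs g) eps then 0 else if Rlt_dec 1 g then 1 else g.

Definition xi_t (t : nat) (v : R) : R :=
  if Rlt_dec (eps * 2 ^ t) (Rabs v) then
    (if Rle_dec (Rabs v) (eps * 2 ^ (S t)) then v else 0)
  else 0.

Definition x0 (i : nat) : R := (1 - eps / 2) / (INR n * colmax i).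

Definition step (x : nat -> R) (t : nat) (i : nat) : R :=
  x i * exp (- alpha * xi_t t (xi (grad x i))).

(* x_k along the sequence ts = [t_0; t_1; ...] of random choices *)
Fixpoint xk (ts : list nat) (k : nat) : nat -> R :=
  match k with
  | O => x0
  | S k' => step (xk ts k') (nth k' ts O)
  end.

Definition Tpar : nat :=
  ceil_nat (Rmax (6 * INR wpar * ln (2 * INR n) / (alpha * eps))
                 (2 * INR wpar ^ 2 * ln (INR n / eps) / eps ^ 2)).

Definition ybar (ts : list nat) (j : nat) : R :=
  / INR Tpar * sumn (fun k => pj (xk ts k) j) Tpar.

Definition lam (ts : list nat) (i : nat) : R :=
  sumn (fun j => A j i * ybar ts j) m - 1 + eps.

(* Algorithm 2; sel i is the chosen row j with A_{j,i} = ||A_{:i}||_inf *)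
Definition ybar' (sel : nat -> nat) (ts : list nat) (j : nat) : R :=
  ybar ts j +
  sumn (fun i => if Rle_dec (lam ts i) (-2 * eps) then
                   (if Nat.eq_dec (sel i) j then - lam ts i / A j i else 0)
                 else 0) n.

Definition y_out (sel : nat -> nat) (ts : list nat) (j : nat) : R :=
  ybar' sel ts j / (1 - 3 * eps).

End Alg.

Fixpoint all_seqs (w T : nat) : list (list nat) :=
  match T with
  | O => [nil]
  | S T' => flat_map (fun t => map (cons t) (all_seqs w T')) (seq 0 w)
  end.

(* probability, under independent uniform t_k in {0..w-1}, of the event P *)
Definition prob_seq (w T : nat) (P : list nat -> bool) : R :=
  INR (length (filter P (all_seqs w T))) / INR (length (all_seqs w T)).

Definition packing_feasible (m n : nat) (A : nat -> nat -> R) (x : nat -> R) : Prop :=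
  (forall i, (i < n)%nat -> 0 <= x i) /\ (forall j, (j < m)%nat -> Ax n A x j <= 1).

Definition packing_values (m n : nat) (A : nat -> nat -> R) (v : R) : Prop :=
  exists x, packing_feasible m n A x /\ v = sumn x n.

(* Main.v *)
Require Import Defs.
From Stdlib Require Import Reals Lra Lia List ZArith.
Import ListNotations.
Open Scope R_scope.

(** Run Algorithm 1 as a mirror descent on [f = - 1^T x + mu * sum_j p_j].
    Every step moves coordinates whose truncated gradients [xi_i] agree up to a
    factor 2, so [f] decreases by at least [(alpha/2) sum_i g_i xi_i x_i] over
    the chosen bucket; as [f(x_0) <= 0], this keeps [f <= 0] and hence
    [A x_k <= 1 + eps] for every outcome of the random choices.

    Comparing with the point 0, the 1-norm of [x_k] together with [2 f] is a
    potential whose expected decrease pays for [sum_i (xi_i + g_i xi_i) x_i],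
    and therefore for [<grad f, x_k>].  Since [p_j] is negligible unless
    [(A x)_j >= 1 - eps], that inner product is at least
    [(1 - eps) 1^T p(x_k) - 1^T x_k - eps], so the expected cost of the average
    of the [p(x_k)] is at most [(1 + O(eps)) OPT].

    As [x_k[i]] stays bounded, the sum over [k] of the sampled truncated
    gradients of coordinate [i] is bounded below.  Algorithm 2 corrects
    coordinate [i] only if the conditional means nevertheless average to at most
    [-2 eps]; an exponential supermartingale shows that this has probability at
    most [eps / n], and each correction costs at most [1 <= OPT].  Finally
    [1^T y >= OPT] always, by weak duality, so Markov's inequality applied to
    [1^T y - OPT >= 0] gives the probability bound. *)

(** * Finite sums *)

Lemma sumn_ext f g k :
  (forall i, (i < k)%nat -> f i = g i) -> sumn f k = sumn g k.
Proof.
  induction k as [|k IH]; intros H; simpl; [reflexivity|].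
  rewrite IH by (intros; apply H; lia). rewrite (H k) by lia. reflexivity.
Qed.

Lemma sumn_le f g k :
  (forall i, (i < k)%nat -> f i <= g i) -> sumn f k <= sumn g k.
Proof.
  induction k as [|k IH]; intros H; simpl; [lra|].
  apply Rplus_le_compat; [apply IH; intros; apply H; lia | apply H; lia].
Qed.

Lemma sumn_plus f g k : sumn (fun i => f i + g i) k = sumn f k + sumn g k.
Proof. induction k as [|k IH]; simpl; [lra | rewrite IH; lra]. Qed.

Lemma sumn_scal c f k : sumn (fun i => c * f i) k = c * sumn f k.
Proof. induction k as [|k IH]; simpl; [lra | rewrite IH; lra]. Qed.

Lemma sumn_const c k : sumn (fun _ => c) k = INR k * c.
Proof.
  induction k as [|k IH]; [simpl; lra|].
  rewrite S_INR; simpl; rewrite IH; lra.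
Qed.

Lemma sumn_nonneg f k : (forall i, (i < k)%nat -> 0 <= f i) -> 0 <= sumn f k.
Proof.
  intros H. replace 0 with (sumn (fun _ => 0) k) by (rewrite sumn_const; lra).
  apply sumn_le, H.
Qed.

Lemma sumn_term_le f k i :
  (forall i, (i < k)%nat -> 0 <= f i) -> (i < k)%nat -> f i <= sumn f k.
Proof.
  induction k as [|k IH]; intros H Hi; [lia|]; simpl.
  assert (0 <= sumn f k) by (apply sumn_nonneg; intros; apply H; lia).
  destruct (Nat.eq_dec i k) as [->|]; [lra|].
  assert (f i <= sumn f k) by (apply IH; [intros; apply H; lia | lia]).
  specialize (H k ltac:(lia)); lra.
Qed.

Lemma sumn_swap f k l :
  sumn (fun i => sumn (fun j => f i j) l) k =
  sumn (fun j => sumn (fun i => f i j) k) l.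
Proof.
  induction k as [|k IH]; simpl; [rewrite sumn_const; lra|].
  rewrite sumn_plus, IH. reflexivity.
Qed.

Lemma sumn_indicator c k j :
  (j < k)%nat -> sumn (fun i => if Nat.eq_dec j i then c else 0) k = c.
Proof.
  assert (Z : forall k, (k <= j)%nat ->
    sumn (fun i => if Nat.eq_dec j i then c else 0) k = 0).
  { induction k0 as [|k0 IH]; intros; simpl; [reflexivity|].
    rewrite IH by lia. destruct (Nat.eq_dec j k0); [lia | lra]. }
  induction k as [|k IH]; intros; [lia|]; simpl.
  destruct (Nat.eq_dec j k) as [->|]; [rewrite Z by lia; lra|].
  rewrite IH by lia; lra.
Qed.

(** * Averages over the sequences of random choices *)

Definition lsum (F : list nat -> R) (l : list (list nat)) : R :=
  fold_right (fun a s => F a + s) 0 l.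

Lemma lsum_app F l l' : lsum F (l ++ l') = lsum F l + lsum F l'.
Proof. induction l as [|a l IH]; simpl; [lra | rewrite IH; lra]. Qed.

Lemma lsum_plus F G l : lsum (fun a => F a + G a) l = lsum F l + lsum G l.
Proof. induction l as [|a l IH]; simpl; [lra | rewrite IH; lra]. Qed.

Lemma lsum_scal c F l : lsum (fun a => c * F a) l = c * lsum F l.
Proof. induction l as [|a l IH]; simpl; [lra | rewrite IH; lra]. Qed.

Lemma lsum_const c l : lsum (fun _ => c) l = INR (length l) * c.
Proof.
  induction l as [|a l IH]; [simpl; lra|].
  cbn [length]; rewrite S_INR; simpl; rewrite IH; lra.
Qed.

Lemma lsum_le F G l :
  (forall a, In a l -> F a <= G a) -> lsum F l <= lsum G l.
Proof.
  induction l as [|a l IH]; intros H; simpl; [lra|].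
  apply Rplus_le_compat; [apply H; now left | apply IH; intros; apply H; now right].
Qed.

Lemma lsum_sumn F k l :
  lsum (fun a => sumn (fun i => F i a) k) l = sumn (fun i => lsum (F i) l) k.
Proof.
  induction k as [|k IH]; simpl; [rewrite lsum_const; lra|].
  rewrite lsum_plus, IH; reflexivity.
Qed.

Lemma lsum_filter (P : list nat -> bool) l :
  lsum (fun a => if P a then 1 else 0) l = INR (length (filter P l)).
Proof.
  induction l as [|a l IH]; [reflexivity|]; cbn [filter lsum fold_right].
  fold (lsum (fun a => if P a then 1 else 0) l); rewrite IH.
  destruct (P a); cbn [length]; [rewrite S_INR|]; lra.
Qed.

Lemma lsum_all_seqs_cons F w T :
  lsum F (all_seqs w (S T)) =
  sumn (fun t => lsum (fun l => F (t :: l)) (all_seqs w T)) w.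
Proof.
  cbn [all_seqs].
  assert (M : forall t L, lsum F (map (cons t) L) = lsum (fun l => F (t :: l)) L).
  { intros t; induction L as [|a L IH]; simpl; [reflexivity | rewrite IH; reflexivity]. }
  assert (Q : forall v, lsum F (flat_map (fun t => map (cons t) (all_seqs w T)) (seq 0 v)) =
    sumn (fun t => lsum (fun l => F (t :: l)) (all_seqs w T)) v).
  { induction v as [|v IH]; [reflexivity|].
    rewrite seq_S, flat_map_app, lsum_app, IH; simpl.
    rewrite app_nil_r, M; reflexivity. }
  apply Q.
Qed.

(** Sequences are enumerated by their first choice, whereas conditioning on the past needs the last
    choice split off. *)
Lemma lsum_all_seqs_snoc F w T :
  lsum F (all_seqs w (S T)) =
  lsum (fun l => sumn (fun t => F (l ++ [t])) w) (all_seqs w T).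
Proof.
  revert F; induction T as [|T IH]; intros F.
  - rewrite lsum_all_seqs_cons; simpl.
    rewrite Rplus_0_r; apply sumn_ext; intros; lra.
  - rewrite lsum_all_seqs_cons, (lsum_all_seqs_cons _ w T).
    apply sumn_ext; intros t _; rewrite IH; reflexivity.
Qed.

Lemma all_seqs_length w T l : In l (all_seqs w T) -> length l = T.
Proof.
  revert l; induction T as [|T IH]; simpl; intros l H.
  - destruct H as [<-|[]]; reflexivity.
  - apply in_flat_map in H as (t & _ & H).
    apply in_map_iff in H as (l' & <- & H); simpl; f_equal; apply IH, H.
Qed.

Lemma all_seqs_card w T : INR (length (all_seqs w T)) = INR w ^ T.
Proof.
  induction T as [|T IH]; [simpl; lra|].
  rewrite <- (Rmult_1_r (INR _)), <- lsum_const, lsum_all_seqs_cons.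
  rewrite (sumn_ext _ (fun _ => INR w ^ T)).
  - rewrite sumn_const; simpl; reflexivity.
  - intros; rewrite lsum_const, IH; lra.
Qed.

Definition expect (w T : nat) (F : list nat -> R) : R :=
  lsum F (all_seqs w T) / INR w ^ T.

Lemma expect_le w T F G : (0 < w)%nat ->
  (forall l, length l = T -> F l <= G l) -> expect w T F <= expect w T G.
Proof.
  intros Hw H; apply Rmult_le_compat_r.
  - apply Rlt_le, Rinv_0_lt_compat, pow_lt, lt_0_INR, Hw.
  - apply lsum_le; intros a Ha; apply H, (all_seqs_length _ _ _ Ha).
Qed.

Lemma expect_plus w T F G :
  expect w T (fun l => F l + G l) = expect w T F + expect w T G.
Proof. unfold expect; rewrite lsum_plus; apply Rdiv_plus_distr. Qed.

Lemma expect_scal w T c F :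
  expect w T (fun l => c * F l) = c * expect w T F.
Proof. unfold expect; rewrite lsum_scal; unfold Rdiv; ring. Qed.

Lemma expect_const w T c : (0 < w)%nat -> expect w T (fun _ => c) = c.
Proof.
  intros Hw; unfold expect; rewrite lsum_const, all_seqs_card; field.
  apply pow_nonzero, not_0_INR; lia.
Qed.

Lemma expect_sumn w T F k :
  expect w T (fun l => sumn (fun i => F i l) k) =
  sumn (fun i => expect w T (F i)) k.
Proof.
  unfold expect; rewrite lsum_sumn; unfold Rdiv.
  rewrite Rmult_comm, <- sumn_scal; apply sumn_ext; intros; ring.
Qed.

Lemma prob_seq_expect w T P :
  prob_seq w T P = expect w T (fun l => if P l then 1 else 0).
Proof. unfold prob_seq, expect; rewrite lsum_filter, all_seqs_card; reflexivity. Qed.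

(** The inner sum over [t], divided by [w], is the conditional expectation of [Phi (S k)] given the
    prefix [l], so the hypothesis is the supermartingale property. *)
Lemma expect_supermartingale w (Phi : nat -> list nat -> R) :
  (0 < w)%nat ->
  (forall k l, length l = k ->
     sumn (fun t => Phi (S k) (l ++ [t])) w <= INR w * Phi k l) ->
  forall T, expect w T (Phi T) <= Phi O [].
Proof.
  intros Hw H; induction T as [|T IH]; [unfold expect; simpl; lra|].
  eapply Rle_trans; [|exact IH].
  assert (Hw' : 0 < INR w) by (apply lt_0_INR, Hw).
  assert (0 < INR w ^ T) by (apply pow_lt, Hw').
  unfold expect at 1; rewrite lsum_all_seqs_snoc.
  replace (expect w T (Phi T))
    with (lsum (fun l => INR w * Phi T l) (all_seqs w T) / INR w ^ S T)
    by (unfold expect; rewrite lsum_scal; simpl; field; lra).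
  apply Rmult_le_compat_r; [apply Rlt_le, Rinv_0_lt_compat, pow_lt, Hw'|].
  apply lsum_le; intros l Hl; apply H, (all_seqs_length _ _ _ Hl).
Qed.

(** Pointwise, the indicator of [Y <= b] is at least [(b - Y) / (b - a)] because [Y >= a]; averaging
    this affine bound gives Markov's inequality for [Y - a]. *)
Lemma expect_markov w T (Y : list nat -> R) a b c :
  (0 < w)%nat -> a < b ->
  (forall l, length l = T -> a <= Y l) ->
  expect w T Y <= a + c * (b - a) ->
  prob_seq w T (fun l => if Rle_dec (Y l) b then true else false) >= 1 - c.
Proof.
  intros Hw Hb Ha HE; rewrite prob_seq_expect; apply Rle_ge.
  set (r := / (b - a)).
  assert (Hr : 0 < r) by (apply Rinv_0_lt_compat; lra).
  assert (Hr1 : r * (b - a) = 1) by (apply Rinv_l; lra).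
  apply Rle_trans with (expect w T (fun l => r * b + (- r) * Y l)).
  - rewrite expect_plus, expect_const, expect_scal by assumption.
    apply (Rmult_le_compat_l r) in HE; [|lra].
    replace (r * (a + c * (b - a))) with (r * a + c * (r * (b - a))) in HE by ring.
    rewrite Hr1 in HE; lra.
  - apply expect_le; [assumption|]; intros l Hl; specialize (Ha l Hl).
    replace (r * b + - r * Y l) with (r * (b - Y l)) by ring.
    destruct (Rle_dec (Y l) b); [|nra].
    rewrite <- Hr1; apply Rmult_le_compat_l; lra.
Qed.

(** * Elementary inequalities *)

Lemma exp_le_mono x y : x <= y -> exp x <= exp y.
Proof. intros [H| ->]; [left; apply exp_increasing, H | right; reflexivity]. Qed.

(** From [exp (- z / 2) >= 1 - z / 2] follows [exp z * (1 - z / 2) ^ 2 <= 1], and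
    [(1 + z + z ^ 2) * (1 - z / 2) ^ 2 >= 1] on this range. *)
Lemma exp_le_quadratic z : Rabs z <= 1 / 4 -> exp z <= 1 + z + z ^ 2.
Proof.
  intros H0; assert (H : - (1 / 4) <= z <= 1 / 4)
    by (unfold Rabs in H0; destruct (Rcase_abs z); lra); clear H0.
  pose proof (exp_ineq1_le (- (z / 2))) as E.
  assert (P : exp (z / 2) * exp (- (z / 2)) = 1)
    by (rewrite <- exp_plus, Rplus_opp_r, exp_0; reflexivity).
  assert (Q : exp z = exp (z / 2) * exp (z / 2))
    by (rewrite <- exp_plus; f_equal; field).
  pose proof (exp_pos (z / 2)) as Hp.
  set (e := exp (z / 2)) in *; set (e' := exp (- (z / 2))) in *.
  rewrite Q.
  assert (B : e * (1 - z / 2) <= 1) by nra.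
  assert (0 <= e * (1 - z / 2)) by nra.
  assert (B2 : e * e * ((1 - z / 2) * (1 - z / 2)) <= 1) by nra.
  assert (B3 : 1 <= (1 + z + z ^ 2) * ((1 - z / 2) * (1 - z / 2))).
  { replace ((1 + z + z ^ 2) * ((1 - z / 2) * (1 - z / 2)))
      with (1 + (z ^ 2 / 4) * (1 - 3 * z + z ^ 2)) by field.
    assert (0 <= 1 - 3 * z + z ^ 2) by nra.
    assert (0 <= z ^ 2) by nra. nra. }
  apply Rmult_le_reg_r with ((1 - z / 2) * (1 - z / 2)); nra.
Qed.

Lemma ceilZ_bounds x : x <= IZR (ceilZ x) < x + 1.
Proof.
  unfold ceilZ; pose proof (archimed x) as [H1 H2].
  destruct (Req_EM_T _ _) as [E|E]; [rewrite minus_IZR; lra|].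
  split; [lra|]. destruct H2 as [H2|H2]; lra.
Qed.

Lemma ceil_nat_bounds x : 0 <= x -> x <= INR (ceil_nat x) < x + 1.
Proof.
  intros H; pose proof (ceilZ_bounds x) as B; unfold ceil_nat.
  assert (0 <= ceilZ x)%Z by (apply le_IZR; lra).
  rewrite INR_IZR_INZ, Z2Nat.id by assumption; exact B.
Qed.

Lemma ln_le_mono x y : 0 < x -> x <= y -> ln x <= ln y.
Proof. intros H [L| ->]; [left; apply ln_increasing; assumption | lra]. Qed.

Lemma ln_le_sub1 x : 0 < x -> ln x <= x - 1.
Proof. intros H; pose proof (exp_ineq1_le (ln x)) as E; rewrite exp_ln in E; lra. Qed.

Lemma ln_ge_0 x : 1 <= x -> 0 <= ln x.
Proof. intros H; rewrite <- ln_1; apply ln_le_mono; lra. Qed.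

(** The half-open buckets [(eps * 2 ^ t, eps * 2 ^ S t]] are disjoint and tile [(eps, eps * 2 ^ k]],
    so at most one term differs from [F 0]. *)
Lemma sumn_xi_t (F : R -> R) eps v k :
  0 < eps -> F 0 = 0 ->
  sumn (fun t => F (xi_t eps t v)) k =
  if Rlt_dec eps (Rabs v) then
    (if Rle_dec (Rabs v) (eps * 2 ^ k) then F v else 0) else 0.
Proof.
  intros He F0; induction k as [|k IH].
  - simpl; destruct (Rlt_dec _ _); [destruct (Rle_dec _ _)|]; lra.
  - cbn [sumn]; rewrite IH; unfold xi_t.
    assert (1 <= 2 ^ k) by (apply pow_R1_Rle; lra).
    assert (eps <= eps * 2 ^ k) by nra.
    assert (eps * 2 ^ S k = 2 * (eps * 2 ^ k)) by (simpl; ring).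
    destruct (Rlt_dec eps (Rabs v)); destruct (Rle_dec (Rabs v) (eps * 2 ^ k));
      destruct (Rlt_dec (eps * 2 ^ k) (Rabs v));
      destruct (Rle_dec (Rabs v) (eps * 2 ^ S k)); lra.
Qed.

Lemma colmax_ge m A j i : (j < m)%nat -> A j i <= colmax m A i.
Proof.
  intros Hj; unfold colmax.
  assert (G : forall l, In j l -> A j i <= fold_right Rmax 0 (map (fun j => A j i) l)).
  { induction l as [|a l IH]; simpl; intros H; [tauto|].
    destruct H as [->|H]; [apply Rmax_l|].
    eapply Rle_trans; [apply IH, H | apply Rmax_r]. }
  apply G, in_seq; lia.
Qed.

Lemma finite_argmax (f : nat -> R) k : (0 < k)%nat ->
  exists j, (j < k)%nat /\ forall i, (i < k)%nat -> f i <= f j.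
Proof.
  induction k as [|k IH]; intros H; [lia|].
  destruct (Nat.eq_dec k 0) as [->|Hk].
  - exists O; split; [lia|]; intros i Hi.
    replace i with O by lia; lra.
  - destruct IH as (j & Hj & Hmax); [lia|].
    destruct (Rle_dec (f k) (f j)) as [C|C].
    + exists j; split; [lia|]; intros i Hi.
      destruct (Nat.eq_dec i k) as [->|]; [exact C | apply Hmax; lia].
    + exists k; split; [lia|]; intros i Hi.
      destruct (Nat.eq_dec i k) as [->|]; [lra|].
      specialize (Hmax i ltac:(lia)); lra.
Qed.

(** * Truncated gradients and the step of one coordinate *)

Lemma xi_cases eps g : 0 < eps -> eps < 1 -> -1 <= g ->
  (xi eps g = 0 /\ Rabs g <= eps) \/
  (xi eps g = g /\ eps < Rabs g /\ g <= 1) \/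
  (xi eps g = 1 /\ 1 < g).
Proof.
  intros; unfold xi; destruct (Rle_dec _ _); [left; auto|].
  destruct (Rlt_dec 1 g); right; [right|left]; repeat split; auto; lra.
Qed.

(** Used, in order, for step sizes, for comparing sums of [xi] with sums of gradients, for monotone
    descent, for recovering the gradient from [xi], and for bucket membership. In the fourth bound
    the product term pays for the cut at 1. *)
Lemma xi_bounds eps g : 0 < eps -> eps < 1 -> -1 <= g ->
  Rabs (xi eps g) <= 1 /\ xi eps g - eps <= g /\ 0 <= g * xi eps g /\
  g <= xi eps g + eps + g * xi eps g /\
  (xi eps g = 0 \/ eps < Rabs (xi eps g)).
Proof.
  intros He He1 Hg.
  destruct (xi_cases eps g He He1 Hg) as [[-> H]|[[-> [H H']]|[-> H]]];
    unfold Rabs in *; repeat destruct (Rcase_abs _); repeat split; try nra;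
    try (left; lra); right; lra.
Qed.

Lemma xi_t_cases eps t v :
  xi_t eps t v = 0 \/
  (xi_t eps t v = v /\ eps * 2 ^ t < Rabs v /\ Rabs v <= eps * 2 ^ S t).
Proof.
  unfold xi_t; destruct (Rlt_dec _ _); [destruct (Rle_dec _ _)|]; auto.
Qed.

(* Within a bucket all truncated gradients agree up to a factor 2, so the
   second-order term is dominated by the first-order decrease. *)
Lemma coordinate_descent eps alpha t g x :
  0 < eps -> eps < 1 -> -1 <= g -> 0 <= x -> 0 < alpha -> alpha <= 1 / 100 ->
  let u := xi_t eps t (xi eps g) in
  let d := x * (exp (- alpha * u) - 1) in
  let M := Rmin 1 (eps * 2 ^ S t) in
  Rabs d <= 11 / 10 * alpha * M * x /\
  g * d + M / 16 * ((1 + g) * Rabs d) <= - (alpha / 2) * (g * u * x).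
Proof.
  intros He He1 Hg Hx Ha Ha1 u d M.
  assert (HP : 0 < eps * 2 ^ S t)
    by (apply Rmult_lt_0_compat; [assumption | apply pow_lt; lra]).
  assert (HM : 0 < M) by (apply Rmin_pos; lra).
  assert (HM1 : M <= 1) by apply Rmin_l.
  assert (HM2 : M <= eps * 2 ^ S t) by apply Rmin_r.
  destruct (xi_bounds eps g He He1 Hg) as (B1 & B2 & B3 & B4 & B5).
  destruct (xi_t_cases eps t (xi eps g)) as [E|(E & L & U)].
  - fold u in E; unfold d; rewrite E, Rmult_0_r, exp_0, Rminus_diag, Rmult_0_r, Rabs_R0.
    assert (0 <= alpha * M) by nra. split; nra.
  - fold u in E.
    assert (HuM : Rabs u <= M) by (rewrite E; apply Rmin_glb; assumption).
    (* The lower end of a bucket is half its upper end, so a nonzero [u] is at least [M / 2] in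
       absolute value. *)
    assert (HMu : M <= 2 * Rabs u) by (rewrite E; simpl in HM2; lra).
    assert (Hau : Rabs (- alpha * u) <= 1 / 100).
    { rewrite Rabs_mult, Rabs_Ropp, (Rabs_right alpha) by lra.
      pose proof (Rabs_pos u); nra. }
    pose proof (exp_ineq1_le (- alpha * u)) as E1.
    pose proof (exp_le_quadratic (- alpha * u) ltac:(lra)) as E2.
    assert (D1 : x * (- alpha * u) <= d) by (apply Rmult_le_compat_l; lra).
    assert (D2 : d <= x * (- alpha * u + (- alpha * u) ^ 2))
      by (apply Rmult_le_compat_l; lra).
    assert (Hax : 0 <= alpha * x) by nra.
    destruct (Rle_or_lt 0 u) as [Hu|Hu].
    + rewrite (Rabs_right u) in * by lra.
      assert (D2' : d <= - (9 / 10) * (alpha * x * u)).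
      { apply (Rle_trans _ _ _ D2).
        replace (x * (- alpha * u + (- alpha * u) ^ 2))
          with (- (alpha * x * u) * (1 - alpha * u)) by ring.
        assert (0 <= alpha * x * u) by nra. assert (alpha * u <= 1 / 100) by nra. nra. }
      assert (Hdn : d <= 0) by (assert (0 <= alpha * x * u) by nra; lra).
      assert (Hda : Rabs d = - d) by (apply Rabs_left1; assumption).
      rewrite Hda; split.
      { assert (alpha * x * u <= alpha * x * M) by nra.
        assert (0 <= alpha * x * M) by nra. nra. }
      (* Either [g = u <= 1] and [M <= 2 * g], or [g > 1 >= M]; a vanishing [xi] contradicts bucket
         membership. *)
      assert (Q : M / 16 * (1 + g) <= g / 4).
      { destruct (xi_cases eps g He He1 Hg) as [[X H]|[[X [H H']]|[X H]]];
          rewrite X in E; [rewrite X, Rabs_R0 in L | | ]; nra. }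
      assert (0 < u).
      { destruct Hu as [Hu|Hu]; [assumption|]. rewrite <- Hu in HMu; lra. }
      assert (Hg0 : 0 <= g).
      { rewrite <- E in B3. nra. }
      assert (g * d <= g * (- (9 / 10) * (alpha * x * u))) by nra.
      assert (M / 16 * (1 + g) * - d <= g / 4 * - d) by nra.
      assert (0 <= g * (alpha * x * u)) by (apply Rmult_le_pos; nra).
      nra.
    + rewrite (Rabs_left u) in * by lra.
      assert (Hdp : 0 <= d) by (assert (0 <= alpha * x * - u) by nra; nra).
      rewrite (Rabs_right d) by lra.
      (* Truncation replaces a gradient only by 0 or 1, so a negative [u] is the gradient itself. *)
      assert (Hgu : g = u).
      { destruct (xi_cases eps g He He1 Hg) as [[X H]|[[X [H H']]|[X H]]]; lra. }
      split.
      { apply (Rle_trans _ _ _ D2).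
        replace (x * (- alpha * u + (- alpha * u) ^ 2))
          with ((alpha * x) * (- u * (1 + alpha * - u))) by ring.
        replace (11 / 10 * alpha * M * x) with ((alpha * x) * (11 / 10 * M)) by ring.
        apply Rmult_le_compat_l; [assumption|].
        assert (alpha * - u <= 1 / 100) by nra. nra. }
      assert (M / 16 * (1 + g) <= - u / 8) by (rewrite Hgu; nra).
      assert (M / 16 * (1 + g) * d <= - u / 8 * d) by nra.
      assert (- u * d >= - u * (alpha * x * - u)) by nra.
      assert (0 <= alpha * x * (u * u)) by (apply Rmult_le_pos; nra).
      rewrite Hgu in *. nra.
Qed.

(** * The algorithm *)

Section Algorithm.

Variables (m n : nat) (A : nat -> nat -> R) (eps OPT : R) (sel : nat -> nat).
Hypothesis (Hm : (0 < m)%nat) (Hn : (0 < n)%nat).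
Hypothesis HA : forall j i, (j < m)%nat -> (i < n)%nat -> 0 <= A j i.
Hypothesis Hcol : forall i, (i < n)%nat -> 1 <= colmax m A i.
Hypothesis Hone : exists i, (i < n)%nat /\ colmax m A i = 1.
Hypothesis (Heps : 0 < eps) (Heps30 : eps <= 1 / 30).
Hypothesis HOPT : is_lub (packing_values m n A) OPT.
Hypothesis Hsel :
  forall i, (i < n)%nat -> (sel i < m)%nat /\ A (sel i) i = colmax m A i.

Local Notation N := (INR n * INR m / eps).
Local Notation mu := (mu m n eps).
Local Notation alpha := (alpha m n eps).
Local Notation pj := (pj m n A eps).
Local Notation grad := (grad m n A eps).
Local Notation Ax := (Ax n A).
Local Notation x0 := (x0 m n A eps).
Local Notation step := (step m n A eps).
Local Notation xk := (xk m n A eps).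
Local Notation xi := (xi eps).
Local Notation xi_t := (xi_t eps).
Local Notation w := (wpar eps).
Local Notation T := (Tpar m n eps).

(** * Sizes of [N] and [mu] *)

Lemma n_ge_1 : 1 <= INR n.
Proof. apply (le_INR 1); lia. Qed.

Lemma m_ge_1 : 1 <= INR m.
Proof. apply (le_INR 1); lia. Qed.

Lemma N_eps : N * eps = INR n * INR m.
Proof. field; lra. Qed.

Lemma N_ge_30 : 30 <= N.
Proof.
  pose proof n_ge_1; pose proof m_ge_1; pose proof N_eps.
  apply Rmult_le_reg_r with eps; nra.
Qed.

Lemma n_le_N_eps : INR n <= N * eps.
Proof. pose proof n_ge_1; pose proof m_ge_1; rewrite N_eps; nra. Qed.

Lemma m_le_N_eps : INR m <= N * eps.
Proof. pose proof n_ge_1; pose proof m_ge_1; rewrite N_eps; nra. Qed.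

Lemma ln_N_gt_3 : 3 < ln N.
Proof.
  pose proof N_ge_30.
  rewrite <- (ln_exp 3); apply ln_increasing; [apply exp_pos|].
  replace 3 with (1 + 1 + 1) by ring; rewrite !exp_plus.
  pose proof exp_le_3; pose proof (exp_pos 1); nra.
Qed.

Lemma mu_pos : 0 < mu.
Proof.
  pose proof ln_N_gt_3; unfold Defs.mu.
  apply Rdiv_lt_0_compat; lra.
Qed.

Lemma mu_ln_N : mu * (4 * ln N) = eps.
Proof. pose proof ln_N_gt_3; unfold Defs.mu; field; lra. Qed.

Lemma mu_le : mu <= eps / 12.
Proof. pose proof ln_N_gt_3; pose proof mu_pos; pose proof mu_ln_N; nra. Qed.

Lemma alpha_bounds : 0 < alpha <= 1 / 100.
Proof. pose proof mu_pos; pose proof mu_le; unfold Defs.alpha; lra. Qed.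

(** The factor 4 in [mu] enters here: changing [(A x)_j] by [eps] changes [p_j] by the factor
    [N ^ 4], which dominates the factors of [n], [m] and [1 / eps] met below. *)
Lemma exp_eps_mu : exp (eps / mu) = N ^ 4.
Proof.
  pose proof ln_N_gt_3; pose proof N_ge_30; pose proof mu_pos.
  replace (eps / mu) with (ln N + ln N + ln N + ln N).
  - rewrite !exp_plus, exp_ln by lra; ring.
  - rewrite <- mu_ln_N at 5; field; lra.
Qed.

Lemma pj_pos x j : 0 < pj x j.
Proof. apply exp_pos. Qed.

Lemma grad_ge x i : (i < n)%nat -> -1 <= grad x i.
Proof.
  intros Hi; unfold Defs.grad.
  assert (0 <= sumn (fun j => A j i * pj x j) m); [|lra].
  apply sumn_nonneg; intros j Hj; apply Rmult_le_pos; [auto | left; apply pj_pos].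
Qed.

(** Transposition [<p, A d> = <A^T p, d>] combined with [A^T p = 1 + grad]. *)
Lemma sum_pj_Ax x d :
  sumn (fun j => pj x j * Ax d j) m = sumn (fun i => (1 + grad x i) * d i) n.
Proof.
  unfold Defs.Ax; erewrite sumn_ext.
  2:{ intros j _; rewrite <- sumn_scal; reflexivity. }
  rewrite sumn_swap; apply sumn_ext; intros i _; unfold Defs.grad.
  rewrite Rplus_comm, <- (Rmult_comm (d i)).
  replace (-1 + sumn (fun j => A j i * pj x j) m + 1)
    with (sumn (fun j => A j i * pj x j) m) by ring.
  rewrite <- sumn_scal; apply sumn_ext; intros; ring.
Qed.

(** * Packing points, [OPT] and duality *)

Definition nonneg (x : nat -> R) := forall i, (i < n)%nat -> 0 <= x i.

Lemma Ax_nonneg x j : nonneg x -> (j < m)%nat -> 0 <= Ax x j.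
Proof. intros Hx Hj; apply sumn_nonneg; intros; apply Rmult_le_pos; auto. Qed.

Lemma coord_le x b i : nonneg x -> (forall j, (j < m)%nat -> Ax x j <= b) ->
  (i < n)%nat -> colmax m A i * x i <= b.
Proof.
  intros Hx Hb Hi; destruct (Hsel i Hi) as [Hj <-].
  eapply Rle_trans; [|apply (Hb _ Hj)].
  apply (sumn_term_le (fun i0 => A (sel i) i0 * x i0)); [|assumption].
  intros; apply Rmult_le_pos; auto.
Qed.

Lemma sum_le_OPT x b : nonneg x -> 0 < b ->
  (forall j, (j < m)%nat -> Ax x j <= b) -> sumn x n <= b * OPT.
Proof.
  intros Hx Hb HAx; destruct HOPT as [U _].
  assert (H : / b * sumn x n <= OPT).
  { apply U; exists (fun i => / b * x i); split; [|rewrite sumn_scal; reflexivity].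
    assert (0 < / b) by (apply Rinv_0_lt_compat, Hb).
    split; [intros i Hi; specialize (Hx i Hi); nra|].
    intros j Hj; unfold Defs.Ax.
    rewrite (sumn_ext _ (fun i => / b * (A j i * x i))) by (intros; ring).
    rewrite sumn_scal; specialize (HAx j Hj); unfold Defs.Ax in HAx.
    apply Rmult_le_reg_l with b; [assumption|].
    rewrite <- Rmult_assoc, Rinv_r; lra. }
  apply Rmult_le_reg_l with (/ b); [apply Rinv_0_lt_compat, Hb|].
  rewrite <- (Rmult_assoc _ b), Rinv_l; lra.
Qed.

(** The unit vector of a column whose largest entry is 1 is feasible. *)
Lemma OPT_ge_1 : 1 <= OPT.
Proof.
  destruct Hone as (i & Hi & Hc); destruct HOPT as [U _]; apply U.
  exists (fun k => if Nat.eq_dec i k then 1 else 0).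
  split; [split|].
  - intros k _; destruct (Nat.eq_dec i k); lra.
  - intros j Hj; unfold Defs.Ax.
    rewrite (sumn_ext _ (fun k => if Nat.eq_dec i k then A j i else 0)).
    + rewrite sumn_indicator by assumption.
      rewrite <- Hc; apply colmax_ge, Hj.
    + intros k _; destruct (Nat.eq_dec i k) as [->|]; ring.
  - rewrite sumn_indicator by assumption; reflexivity.
Qed.

(** The vector [y / c] is a covering solution, and pairing [y] with [A x] bounds every packing value
    by its cost. *)
Lemma weak_duality y c :
  (forall j, (j < m)%nat -> 0 <= y j) ->
  (forall i, (i < n)%nat -> c <= sumn (fun j => A j i * y j) m) ->
  0 < c -> c * OPT <= sumn y m.
Proof.
  intros Hy Hc c0; destruct HOPT as [_ L].
  assert (H : OPT <= / c * sumn y m).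
  { apply L; intros v (x & [Hx HAx] & ->).
    apply Rmult_le_reg_l with c; [assumption|].
    rewrite <- Rmult_assoc, Rinv_r, Rmult_1_l by lra.
    rewrite <- sumn_scal.
    apply Rle_trans with (sumn (fun i => sumn (fun j => A j i * y j) m * x i) n).
    - apply sumn_le; intros i Hi; apply Rmult_le_compat_r; auto.
    - rewrite (sumn_ext _ (fun i => sumn (fun j => y j * (A j i * x i)) m)).
      + rewrite sumn_swap; apply sumn_le; intros j Hj; rewrite sumn_scal.
        specialize (HAx j Hj); specialize (Hy j Hj); unfold Defs.Ax in HAx; nra.
      + intros i Hi; rewrite Rmult_comm, <- sumn_scal.
        apply sumn_ext; intros; ring. }
  apply Rmult_le_reg_l with (/ c); [apply Rinv_0_lt_compat, c0|].
  rewrite <- Rmult_assoc, Rinv_l; lra.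
Qed.

(** * The smoothed objective: feasibility, start and one step *)

Definition fmu (x : nat -> R) : R := - sumn x n + mu * sumn (pj x) m.

(** Suppose the largest excess [v] is above [eps]. Then [p_j >= N ^ 4 * (1 + v - eps)], while
    [f <= 0] gives [mu * p_j <= 1^T x <= n * (1 + v)]. This is impossible because [mu * N ^ 4]
    exceeds [2 * n]. *)
Lemma fmu_nonpos_Ax x :
  nonneg x -> fmu x <= 0 -> forall j, (j < m)%nat -> Ax x j <= 1 + eps.
Proof.
  intros Hx Hf.
  destruct (finite_argmax (Ax x) m Hm) as (j & Hj & Hmax).
  assert (Ax x j <= 1 + eps); [|intros; eapply Rle_trans; eauto].
  apply Rnot_lt_le; intros Hlt; set (v := Ax x j - 1).
  (* Column maxima are at least 1, so no coordinate exceeds the largest entry [1 + v] of [A x]. *)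
  assert (Hs : sumn x n <= INR n * (1 + v)).
  { rewrite <- sumn_const; apply sumn_le; intros i Hi.
    pose proof (coord_le x _ i Hx Hmax Hi) as C.
    pose proof (Hcol i Hi) as C1; pose proof (Hx i Hi); unfold v; nra. }
  assert (Hp : pj x j <= sumn (pj x) m)
    by (apply sumn_term_le; [intros; left; apply pj_pos | assumption]).
  assert (Hpv : N ^ 4 * (1 + (v - eps)) <= pj x j).
  { unfold Defs.pj; fold v.
    replace (v / mu) with (eps / mu + (v - eps) / mu)
      by (field; pose proof mu_pos; lra).
    rewrite exp_plus, exp_eps_mu.
    apply Rmult_le_compat_l; [apply pow_le; pose proof N_ge_30; lra|].
    eapply Rle_trans; [|apply exp_ineq1_le].
    apply Rplus_le_compat_l; unfold Rdiv.
    rewrite <- (Rmult_1_r (v - eps)) at 1.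
    apply Rmult_le_compat_l; [unfold v; lra|].
    rewrite <- Rinv_1; apply Rinv_le_contravar;
      [apply mu_pos | pose proof mu_le; lra]. }
  pose proof mu_pos; pose proof N_ge_30; pose proof n_le_N_eps.
  assert (Hv : eps < v) by (unfold v; lra).
  unfold fmu in Hf.
  assert (F1 : mu * (N ^ 4 * ((1 + v) / 2)) <= INR n * (1 + v)).
  { apply Rle_trans with (mu * pj x j).
    2:{ apply Rle_trans with (mu * sumn (pj x) m); [apply Rmult_le_compat_l|]; lra. }
    apply Rmult_le_compat_l; [lra|].
    eapply Rle_trans; [|exact Hpv].
    apply Rmult_le_compat_l; [apply pow_le|]; lra. }
  assert (F2 : mu * N ^ 4 <= 2 * INR n) by nra.
  (* The bound [ln N <= N] removes the logarithm hidden in [mu], leaving a polynomial contradiction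
     in [N] and [eps]. *)
  assert (F3 : eps <= 4 * mu * N).
  { pose proof mu_ln_N.
    pose proof (ln_le_sub1 N ltac:(lra)).
    assert (mu * ln N <= mu * N) by (apply Rmult_le_compat_l; lra). lra. }
  assert (F4 : eps * N ^ 3 <= 8 * (N * eps)).
  { apply Rle_trans with (4 * (mu * N ^ 4)); [|lra].
    replace (4 * (mu * N ^ 4)) with (4 * mu * N * N ^ 3) by ring.
    apply Rmult_le_compat_r; [apply pow_le|]; lra. }
  assert (0 < N * eps) by nra.
  assert (900 <= N ^ 2) by nra.
  replace (eps * N ^ 3) with (N * eps * N ^ 2) in F4 by ring.
  nra.
Qed.

Lemma x0_colmax i : (i < n)%nat -> colmax m A i * x0 i = (1 - eps / 2) / INR n.
Proof.
  intros Hi; pose proof (Hcol i Hi); pose proof n_ge_1; unfold Defs.x0; field; lra.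
Qed.

Lemma x0_pos i : (i < n)%nat -> 0 < x0 i.
Proof.
  intros Hi; pose proof (Hcol i Hi); pose proof n_ge_1.
  apply Rdiv_lt_0_compat; nra.
Qed.

Lemma Ax_x0 j : (j < m)%nat -> Ax x0 j <= 1 - eps / 2.
Proof.
  intros Hj; pose proof n_ge_1.
  replace (1 - eps / 2) with (sumn (fun _ => (1 - eps / 2) / INR n) n)
    by (rewrite sumn_const; field; lra).
  apply sumn_le; intros i Hi; rewrite <- (x0_colmax i Hi).
  apply Rmult_le_compat_r; [left; apply x0_pos, Hi | apply colmax_ge, Hj].
Qed.

(** The slack [eps / 2] of the starting point forces [p_j <= N ^ -2], so the barrier term stays
    below the mass, about [1 / n], of the column whose maximum is 1. *)
Lemma fmu_x0 : fmu x0 <= 0.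
Proof.
  pose proof n_ge_1; pose proof mu_pos; pose proof N_ge_30.
  destruct Hone as (i & Hi & Hc).
  assert (S : (1 - eps / 2) / INR n <= sumn x0 n).
  { rewrite <- (x0_colmax i Hi), Hc, Rmult_1_l.
    apply sumn_term_le; [intros; left; apply x0_pos|]; assumption. }
  assert (P : forall j, (j < m)%nat -> pj x0 j * N ^ 2 <= 1).
  { intros j Hj.
    (* The slack is half of [eps], so it is the square of [p_j] that [exp_eps_mu] compares with
       [N ^ 4]. *)
    assert (Q : (pj x0 j * N ^ 2) * (pj x0 j * N ^ 2) <= 1 * 1).
    { replace (pj x0 j * N ^ 2 * (pj x0 j * N ^ 2))
        with (pj x0 j * pj x0 j * N ^ 4) by ring.
      rewrite <- exp_eps_mu; unfold Defs.pj; rewrite <- !exp_plus, Rmult_1_l.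
      apply Rle_trans with (exp 0); [apply exp_le_mono | rewrite exp_0; lra].
      replace ((Ax x0 j - 1) / mu + (Ax x0 j - 1) / mu + eps / mu)
        with ((2 * (Ax x0 j - 1) + eps) / mu) by (field; lra).
      pose proof (Ax_x0 j Hj).
      assert (0 < / mu) by (apply Rinv_0_lt_compat; lra).
      unfold Rdiv; nra. }
    pose proof (pj_pos x0 j).
    assert (0 < N ^ 2) by (apply pow_lt; lra).
    set (u := pj x0 j * N ^ 2) in *; assert (0 < u) by (apply Rmult_lt_0_compat; lra).
    nra. }
  assert (Q : sumn (pj x0) m * N ^ 2 <= INR m).
  { rewrite Rmult_comm, <- sumn_scal.
    apply Rle_trans with (sumn (fun _ => 1) m); [|rewrite sumn_const; lra].
    apply sumn_le; intros j Hj; rewrite Rmult_comm; auto. }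
  unfold fmu.
  set (s := sumn (pj x0) m) in *.
  assert (Hs : 0 <= s) by (apply sumn_nonneg; intros; left; apply pj_pos).
  pose proof m_le_N_eps; pose proof mu_le; pose proof n_le_N_eps.
  assert (s * N <= eps) by (apply Rmult_le_reg_r with N; nra).
  assert (Hn' : s * INR n <= eps * eps)
    by (apply Rle_trans with (s * (N * eps)); [apply Rmult_le_compat_l|]; nra).
  assert (mu * s * INR n <= 1 / 2) by nra.
  assert (mu * s <= (1 - eps / 2) / INR n); [|lra].
  apply Rmult_le_reg_r with (INR n); [lra|].
  replace ((1 - eps / 2) / INR n * INR n) with (1 - eps / 2) by (field; lra); lra.
Qed.

Lemma step_pos x t i : 0 < x i -> 0 < step x t i.
Proof. intros H; apply Rmult_lt_0_compat; [assumption | apply exp_pos]. Qed.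

(** Expand each [p_j] to second order. The exponent moves by at most [M / 16], so the quadratic term
    is at most [M / 16] times [<p, A |d|>]; transposition turns this into a sum over coordinates,
    and [coordinate_descent] absorbs it. *)
Lemma fmu_step x t :
  nonneg x -> (forall j, (j < m)%nat -> Ax x j <= 1 + eps) ->
  fmu (step x t) <= fmu x -
    alpha / 2 * sumn (fun i => grad x i * xi_t t (xi (grad x i)) * x i) n.
Proof.
  intros Hx HAx.
  pose proof mu_pos as Hmu; pose proof alpha_bounds as [Ha Ha1].
  set (d := fun i => x i * (exp (- alpha * xi_t t (xi (grad x i))) - 1)).
  set (M := Rmin 1 (eps * 2 ^ S t)).
  assert (HP : 0 < eps * 2 ^ S t)
    by (apply Rmult_lt_0_compat; [assumption | apply pow_lt; lra]).
  assert (HM : 0 < M) by (apply Rmin_pos; lra).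
  assert (HM1 : M <= 1) by apply Rmin_l.
  assert (Hd : forall i, (i < n)%nat ->
    Rabs (d i) <= 11 / 10 * alpha * M * x i /\
    grad x i * d i + M / 16 * ((1 + grad x i) * Rabs (d i)) <=
      - (alpha / 2) * (grad x i * xi_t t (xi (grad x i)) * x i)).
  { intros i Hi; apply coordinate_descent; try lra; auto.
    apply grad_ge, Hi. }
  assert (Hstep : sumn (step x t) n = sumn x n + sumn d n).
  { rewrite <- sumn_plus; apply sumn_ext; intros; unfold Defs.step, d; ring. }
  assert (HAstep : forall j, Ax (step x t) j = Ax x j + Ax d j).
  { intros j; unfold Defs.Ax; rewrite <- sumn_plus; apply sumn_ext; intros.
    unfold Defs.step, d; ring. }
  set (ad := fun i => Rabs (d i)).
  assert (HAd : forall j, (j < m)%nat -> Rabs (Ax d j) <= Ax ad j).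
  { intros j Hj; unfold Defs.Ax, ad; apply Rabs_le; split.
    - rewrite <- (Rmult_1_l (sumn _ _)), Ropp_mult_distr_l, <- sumn_scal.
      apply sumn_le; intros i Hi; pose proof (HA j i Hj Hi).
      pose proof (Rle_abs (- d i)) as R1; rewrite Rabs_Ropp in R1; nra.
    - apply sumn_le; intros i Hi; pose proof (HA j i Hj Hi).
      pose proof (Rle_abs (d i)); nra. }
  (* The constants fit because [alpha = mu / 20] and [11 / 10 * (31 / 30) / 20 <= 1 / 16]. *)
  assert (HAad : forall j, (j < m)%nat -> Ax ad j <= M / 16 * mu).
  { intros j Hj.
    apply Rle_trans with (11 / 10 * alpha * M * Ax x j).
    - unfold Defs.Ax; rewrite <- sumn_scal; apply sumn_le; intros i Hi.
      destruct (Hd i Hi) as [D _]; pose proof (HA j i Hj Hi).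
      replace (11 / 10 * alpha * M * (A j i * x i))
        with (A j i * (11 / 10 * alpha * M * x i)) by ring.
      apply Rmult_le_compat_l; assumption.
    - specialize (HAx j Hj).
      assert (0 < mu * M) by nra.
      unfold Defs.alpha; nra. }
  assert (Hexp : forall j, (j < m)%nat ->
    mu * pj (step x t) j <=
    mu * pj x j + pj x j * Ax d j + M / 16 * (pj x j * Ax ad j)).
  { intros j Hj; specialize (HAd j Hj); specialize (HAad j Hj).
    assert (E : pj (step x t) j = pj x j * exp (Ax d j / mu)).
    { unfold Defs.pj; rewrite HAstep, <- exp_plus; f_equal; field; lra. }
    set (z := Ax d j / mu) in *.
    assert (Hz : Ax d j = mu * z) by (unfold z; field; lra).
    assert (Hzb : Rabs z <= M / 16).
    { rewrite Hz, Rabs_mult, (Rabs_right mu) in HAd by lra.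
      apply Rmult_le_reg_l with mu; lra. }
    pose proof (exp_le_quadratic z ltac:(lra)) as Q.
    assert (Z2 : mu * z ^ 2 <= M / 16 * Ax ad j).
    { rewrite <- (pow2_abs z); rewrite Hz, Rabs_mult, (Rabs_right mu) in HAd by lra.
      pose proof (Rabs_pos z).
      apply Rle_trans with (M / 16 * (mu * Rabs z)); [|nra].
      replace (mu * Rabs z ^ 2) with (Rabs z * (mu * Rabs z)) by ring.
      apply Rmult_le_compat_r; nra. }
    rewrite E, Hz.
    replace (mu * pj x j + pj x j * (mu * z) + M / 16 * (pj x j * Ax ad j))
      with (pj x j * (mu * (1 + z) + M / 16 * Ax ad j)) by ring.
    replace (mu * (pj x j * exp z)) with (pj x j * (mu * exp z)) by ring.
    apply Rmult_le_compat_l; [left; apply pj_pos|].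
    apply Rle_trans with (mu * (1 + z + z ^ 2)); [apply Rmult_le_compat_l|]; lra. }
  assert (Hsum : mu * sumn (pj (step x t)) m <=
    mu * sumn (pj x) m + sumn (fun i => (1 + grad x i) * d i) n +
    M / 16 * sumn (fun i => (1 + grad x i) * ad i) n).
  { rewrite <- !sum_pj_Ax, <- !sumn_scal, <- !sumn_plus.
    apply sumn_le, Hexp. }
  unfold fmu; rewrite Hstep.
  assert (Hfin : sumn (fun i => grad x i * d i + M / 16 * ((1 + grad x i) * ad i)) n
    <= - (alpha / 2) * sumn (fun i => grad x i * xi_t t (xi (grad x i)) * x i) n).
  { rewrite <- sumn_scal; apply sumn_le; intros i Hi; apply (Hd i Hi). }
  rewrite sumn_plus, sumn_scal in Hfin.
  rewrite (sumn_ext (fun i => (1 + grad x i) * d i) (fun i => d i + grad x i * d i))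
    in Hsum by (intros; ring).
  rewrite sumn_plus in Hsum.
  change (fun i => d i) with d in Hsum. lra.
Qed.

(** * Parameters *)

Lemma w_pos : (0 < w)%nat.
Proof.
  apply INR_lt; simpl.
  assert (0 < log2 (1 / eps)).
  { pose proof ln_lt_2; apply Rdiv_lt_0_compat; [|lra].
    rewrite <- ln_1; apply ln_increasing; [lra|].
    apply Rmult_lt_reg_r with eps; [assumption|].
    unfold Rdiv; rewrite Rmult_assoc, Rinv_l; lra. }
  pose proof (ceil_nat_bounds (log2 (1 / eps))); unfold wpar; lra.
Qed.

Lemma w_ge_1 : 1 <= INR w.
Proof. apply (le_INR 1), w_pos. Qed.

Lemma inv_eps_ge_30 : 30 <= 1 / eps.
Proof.
  apply Rmult_le_reg_r with eps; [assumption|].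
  unfold Rdiv; rewrite Rmult_assoc, Rinv_l; lra.
Qed.

Lemma ln_inv_eps_ge_3 : 3 <= ln (1 / eps).
Proof.
  pose proof inv_eps_ge_30.
  rewrite <- (ln_exp 3); apply ln_le_mono; [apply exp_pos|].
  replace 3 with (1 + 1 + 1) by ring; rewrite !exp_plus.
  pose proof exp_le_3; pose proof (exp_pos 1); nra.
Qed.

Lemma log2_inv_eps_bounds :
  0 <= log2 (1 / eps) <= 2 * ln (1 / eps).
Proof.
  pose proof ln_inv_eps_ge_3; pose proof ln_lt_2.
  assert (E : log2 (1 / eps) * ln 2 = ln (1 / eps))
    by (unfold log2; field; lra).
  nra.
Qed.

Lemma w_le : INR w <= 3 * ln (1 / eps).
Proof.
  pose proof ln_inv_eps_ge_3; pose proof log2_inv_eps_bounds.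
  pose proof (ceil_nat_bounds (log2 (1 / eps)) ltac:(lra)); unfold wpar; lra.
Qed.

(** Hence the [w] buckets reach up to 1 and contain every nonzero truncated gradient. *)
Lemma eps_pow2_w : 1 <= eps * 2 ^ w.
Proof.
  pose proof ln_lt_2; pose proof log2_inv_eps_bounds; pose proof inv_eps_ge_30.
  assert (H2 : 1 / eps <= 2 ^ w).
  { rewrite <- (exp_ln (1 / eps)) by lra.
    rewrite <- (exp_ln (2 ^ w)) by (apply pow_lt; lra).
    apply exp_le_mono; rewrite ln_pow by lra.
    replace (ln (1 / eps)) with (log2 (1 / eps) * ln 2) by (unfold log2; field; lra).
    apply Rmult_le_compat_r; [lra|].
    apply (ceil_nat_bounds (log2 (1 / eps))); lra. }
  replace 1 with (eps * (1 / eps)) by (field; lra).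
  apply Rmult_le_compat_l; lra.
Qed.

(** Exactly one bucket contains a nonzero [xi g], so a uniformly chosen [t] gives the conditional
    mean [F (xi g) / w]. *)
Lemma sumn_bucket (F : R -> R) g :
  -1 <= g -> F 0 = 0 -> sumn (fun t => F (xi_t t (xi g))) w = F (xi g).
Proof.
  intros Hg HF; rewrite sumn_xi_t by assumption.
  pose proof eps_pow2_w.
  destruct (xi_bounds eps g Heps ltac:(lra) Hg) as (B & _ & _ & _ & [E|E]).
  - rewrite E, HF; destruct (Rlt_dec _ _); [destruct (Rle_dec _ _)|]; reflexivity.
  - destruct (Rlt_dec _ _); [destruct (Rle_dec _ _)|]; lra.
Qed.

Lemma ln_2n_ge : 1 / 2 <= ln (2 * INR n).
Proof.
  pose proof n_ge_1; pose proof ln_lt_2.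
  apply Rle_trans with (ln 2); [lra | apply ln_le_mono; lra].
Qed.

Lemma ln_n_eps_bounds : 0 <= ln (INR n / eps) <= ln N.
Proof.
  pose proof n_ge_1; pose proof m_ge_1; pose proof inv_eps_ge_30.
  assert (H2 : 1 <= INR n / eps).
  { replace (INR n / eps) with (INR n * (1 / eps)) by (field; lra). nra. }
  split; [apply ln_ge_0, H2|].
  apply ln_le_mono; [lra|].
  replace N with (INR n / eps * INR m) by (field; lra). nra.
Qed.

Lemma T_bounds :
  let b1 := 6 * INR w * ln (2 * INR n) / (alpha * eps) in
  let b2 := 2 * INR w ^ 2 * ln (INR n / eps) / eps ^ 2 in
  b1 <= INR T /\ b2 <= INR T /\ (INR T <= b1 + 1 \/ INR T <= b2 + 1) /\ 0 < INR T.
Proof.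
  intros b1 b2.
  assert (H1 : 0 < b1).
  { pose proof w_ge_1; pose proof ln_2n_ge; pose proof alpha_bounds.
    apply Rdiv_lt_0_compat; nra. }
  pose proof (Rmax_l b1 b2); pose proof (Rmax_r b1 b2).
  pose proof (ceil_nat_bounds (Rmax b1 b2) ltac:(lra)) as B.
  change (ceil_nat (Rmax b1 b2)) with T in B.
  repeat split; try lra.
  destruct (Rmax_case_strong b1 b2 (fun r => r = b1 \/ r = b2)) as [E|E]; auto;
    rewrite E in B; [left|right]; lra.
Qed.

Lemma T_ge_ln_2n : INR w / alpha * ln (2 * INR n) <= eps * INR T / 6.
Proof.
  destruct T_bounds as (H & _); pose proof alpha_bounds.
  replace (INR w / alpha * ln (2 * INR n))
    with (eps / 6 * (6 * INR w * ln (2 * INR n) / (alpha * eps))) by (field; lra).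
  replace (eps * INR T / 6) with (eps / 6 * INR T) by field.
  apply Rmult_le_compat_l; lra.
Qed.

Lemma T_ge_w_alpha : INR w / alpha <= eps * INR T / 3.
Proof.
  pose proof T_ge_ln_2n; pose proof ln_2n_ge; pose proof w_ge_1.
  pose proof alpha_bounds.
  assert (0 < INR w / alpha) by (apply Rdiv_lt_0_compat; lra).
  nra.
Qed.

Lemma T_ge_ln_n_eps : 2 * INR w ^ 2 * ln (INR n / eps) <= eps ^ 2 * INR T.
Proof.
  destruct T_bounds as (_ & H & _).
  replace (2 * INR w ^ 2 * ln (INR n / eps))
    with (eps ^ 2 * (2 * INR w ^ 2 * ln (INR n / eps) / eps ^ 2)) by (field; lra).
  apply Rmult_le_compat_l; [apply pow_le; lra | assumption].
Qed.

(** Both terms of the maximum reduce to this form through [w <= 3 * ln (1 / eps)],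
    [1 / alpha = 80 * ln N / eps] and [ln (n / eps) <= ln N]. The second term lacks the factor
    [ln (2 * n)], whose insertion costs a factor 2. *)
Lemma T_upper :
  INR T <= 1000 * (ln (1 / eps) ^ 2 * ln N * ln (2 * INR n) / eps ^ 2).
Proof.
  pose proof w_le as Hw; pose proof w_ge_1; pose proof ln_inv_eps_ge_3 as Hl.
  pose proof ln_N_gt_3 as HN; pose proof ln_2n_ge as H2n.
  pose proof ln_n_eps_bounds as [Hne Hne'].
  destruct T_bounds as (_ & _ & B & _).
  set (l := ln (1 / eps)) in *; set (a := ln (2 * INR n)) in *.
  set (q := ln (INR n / eps)) in *.
  assert (He : 1 <= / eps ^ 2).
  { rewrite <- Rinv_1; apply Rinv_le_contravar; [apply pow_lt|]; nra. }
  assert (E1 : 6 * INR w * a / (alpha * eps) = 480 * (INR w * ln N * a) * / eps ^ 2).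
  { unfold Defs.alpha, Defs.mu; field; lra. }
  rewrite E1 in B.
  assert (P0 : 0 < ln N * a) by (apply Rmult_lt_0_compat; lra).
  assert (P1 : INR w * ln N * a <= l ^ 2 * ln N * a).
  { rewrite !Rmult_assoc; apply Rmult_le_compat_r; nra. }
  assert (P2 : INR w ^ 2 * q <= 18 * (l ^ 2 * ln N * a)).
  { apply Rle_trans with (9 * l ^ 2 * ln N).
    - apply Rmult_le_compat; nra.
    - assert (0 < l ^ 2 * ln N) by (apply Rmult_lt_0_compat; nra). nra. }
  assert (P3 : 1 <= l ^ 2 * ln N * a).
  { assert (9 <= l ^ 2) by nra. assert (1 <= ln N * a) by nra. nra. }
  set (K := l ^ 2 * ln N * a) in *.
  unfold Rdiv; rewrite <- Rmult_assoc.
  assert (P4 : 1 <= K * / eps ^ 2) by nra.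
  set (r := / eps ^ 2) in *.
  assert (INR w * ln N * a * r <= K * r) by (apply Rmult_le_compat_r; lra).
  assert (INR w ^ 2 * q * r <= 18 * K * r) by (apply Rmult_le_compat_r; lra).
  unfold Rdiv in B; fold r in B.
  destruct B as [B|B]; nra.
Qed.

(** * Trajectory and regret *)

Lemma xk_pos ts k i : (i < n)%nat -> 0 < xk ts k i.
Proof.
  intros Hi; induction k as [|k IH]; simpl; [apply x0_pos, Hi | apply step_pos, IH].
Qed.

Lemma xk_nonneg ts k : nonneg (xk ts k).
Proof. intros i Hi; left; apply xk_pos, Hi. Qed.

(** The induction closes because [f <= 0] gives approximate feasibility, the hypothesis under which
    the next step cannot increase [f]. *)
Lemma fmu_xk ts k : fmu (xk ts k) <= 0.
Proof.
  induction k as [|k IH]; [apply fmu_x0|].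
  pose proof (xk_nonneg ts k) as Hx.
  pose proof (fmu_step (xk ts k) (nth k ts O) Hx (fmu_nonpos_Ax _ Hx IH)) as D.
  simpl; eapply Rle_trans; [exact D|].
  pose proof alpha_bounds.
  match goal with |- _ - alpha / 2 * ?s <= 0 => assert (0 <= s); [|nra] end.
  apply sumn_nonneg; intros i Hi; apply Rmult_le_pos; [|auto].
  destruct (xi_bounds eps _ Heps ltac:(lra) (grad_ge (xk ts k) i Hi)) as (_ & _ & B & _).
  destruct (xi_t_cases eps (nth k ts O) (xi (grad (xk ts k) i))) as [->|[-> _]]; lra.
Qed.

Lemma Ax_xk ts k j : (j < m)%nat -> Ax (xk ts k) j <= 1 + eps.
Proof. apply fmu_nonpos_Ax; [apply xk_nonneg | apply fmu_xk]. Qed.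

(** Iterates are adapted: [x_k] depends only on the first [k] choices. *)
Lemma xk_app ts l k : (k <= length ts)%nat -> xk (ts ++ l) k = xk ts k.
Proof.
  induction k as [|k IH]; intros H; simpl; [reflexivity|].
  rewrite IH, app_nth1 by lia; reflexivity.
Qed.

Lemma xk_snoc ts t : xk (ts ++ [t]) (S (length ts)) = step (xk ts (length ts)) t.
Proof. simpl; rewrite xk_app, nth_middle by lia; reflexivity. Qed.

(** Two first-order gains added together: the mirror-descent term against the comparator 0, and the
    decrease of [f]. Together with [eps * 1^T x] they bound [<grad f, x>] from above. *)
Definition regret (x : nat -> R) : R :=
  sumn (fun i => xi (grad x i) * x i) n +
  sumn (fun i => grad x i * xi (grad x i) * x i) n.

Lemma sum_step_le x t : nonneg x ->
  sumn (step x t) n <=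
  sumn x n + (- alpha * sumn (fun i => xi_t t (xi (grad x i)) * x i) n +
              alpha ^ 2 * sumn (fun i => xi_t t (xi (grad x i)) ^ 2 * x i) n).
Proof.
  intros Hx; pose proof alpha_bounds.
  rewrite <- !sumn_scal, <- !sumn_plus; apply sumn_le; intros i Hi.
  destruct (xi_bounds eps _ Heps ltac:(lra) (grad_ge x i Hi)) as (B & _).
  assert (B' : Rabs (xi_t t (xi (grad x i))) <= 1).
  { destruct (xi_t_cases eps t (xi (grad x i))) as [->|[-> _]];
      [rewrite Rabs_R0; lra | assumption]. }
  set (u := xi_t t (xi (grad x i))) in *.
  assert (Rabs (- alpha * u) <= 1 / 4).
  { rewrite Rabs_mult, Rabs_Ropp, (Rabs_right alpha) by lra.
    pose proof (Rabs_pos u); nra. }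
  pose proof (exp_le_quadratic (- alpha * u) ltac:(assumption)) as E.
  replace (x i + (- alpha * (u * x i) + alpha ^ 2 * (u ^ 2 * x i)))
    with (x i * (1 + - alpha * u + (- alpha * u) ^ 2)) by ring.
  apply Rmult_le_compat_l; [apply Hx, Hi | exact E].
Qed.

(* Mirror descent against the comparator 0 (the 1-norm of x telescopes) plus the
   decrease of fmu, which pays for the truncation of gradients above 1. *)
Definition potential (x : nat -> R) : R :=
  INR w / alpha * sumn x n + 2 * (INR w / alpha) * fmu x.

(** Summed over [t], the first-order changes combine to [- w * regret x]. The second-order change is
    at most [w * alpha * 1^T x], and [1^T x <= 2 * OPT] by approximate feasibility. *)
Lemma potential_step x : nonneg x -> (forall j, (j < m)%nat -> Ax x j <= 1 + eps) ->
  sumn (fun t => potential (step x t)) w <=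
  INR w * (potential x - regret x + 2 * alpha * OPT).
Proof.
  intros Hx HAx; pose proof alpha_bounds as [Ha Ha1]; pose proof w_ge_1.
  set (c := INR w / alpha).
  assert (Hc : 0 < c) by (apply Rdiv_lt_0_compat; lra).
  assert (Hca : c * alpha = INR w) by (unfold c; field; lra).
  set (U t := sumn (fun i => xi_t t (xi (grad x i)) * x i) n).
  set (V t := sumn (fun i => xi_t t (xi (grad x i)) ^ 2 * x i) n).
  set (W t := sumn (fun i => grad x i * xi_t t (xi (grad x i)) * x i) n).
  assert (SU : sumn U w = sumn (fun i => xi (grad x i) * x i) n).
  { unfold U; rewrite sumn_swap; apply sumn_ext; intros i Hi.
    apply (sumn_bucket (fun v => v * x i)); [apply grad_ge, Hi | ring]. }
  assert (SV : sumn V w <= 2 * OPT).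
  { unfold V; rewrite sumn_swap.
    apply Rle_trans with (sumn x n).
    - apply sumn_le; intros i Hi.
      rewrite (sumn_bucket (fun v => v ^ 2 * x i)); [|apply grad_ge, Hi | ring].
      destruct (xi_bounds eps _ Heps ltac:(lra) (grad_ge x i Hi)) as (B & _).
      rewrite <- pow2_abs; pose proof (Rabs_pos (xi (grad x i))).
      specialize (Hx i Hi).
      assert (Rabs (xi (grad x i)) ^ 2 <= 1) by nra. nra.
    - pose proof (sum_le_OPT x (1 + eps) Hx ltac:(lra) HAx).
      pose proof OPT_ge_1; nra. }
  assert (SW : sumn W w = sumn (fun i => grad x i * xi (grad x i) * x i) n).
  { unfold W; rewrite sumn_swap; apply sumn_ext; intros i Hi.
    apply (sumn_bucket (fun v => grad x i * v * x i)); [apply grad_ge, Hi | ring]. }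
  (* The weight 2 on [fmu] cancels the [1 / 2] in [fmu_step], so both gains carry the common factor
     [c * alpha = w]. *)
  apply Rle_trans with (sumn (fun t => potential x +
    ((- (c * alpha)) * U t + (c * alpha * alpha * V t + (- (c * alpha)) * W t))) w).
  - apply sumn_le; intros t _; unfold potential; fold c.
    pose proof (sum_step_le x t Hx) as P; pose proof (fmu_step x t Hx HAx) as Q.
    fold (U t) (V t) in P; fold (W t) in Q.
    apply Rle_trans with (c * (sumn x n + (- alpha * U t + alpha ^ 2 * V t)) +
      2 * c * (fmu x - alpha / 2 * W t)); [|right; field].
    apply Rplus_le_compat; apply Rmult_le_compat_l; lra.
  - rewrite !sumn_plus, !sumn_scal, sumn_const, SU, SW, Hca; unfold regret.
    assert (INR w * alpha * sumn V w <= INR w * alpha * (2 * OPT))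
      by (apply Rmult_le_compat_l; nra).
    nra.
Qed.

(** Accumulated regret plus potential, minus the second-order drift, is a supermartingale. The
    potential starts at most at [w / alpha * OPT] and ends at least at
    [- (w / alpha) * (1 + eps) * OPT]; the choice of [T] keeps the difference plus the drift below
    [eps * T * OPT]. *)
Lemma expect_regret :
  expect w T (fun ts => sumn (fun k => regret (xk ts k)) T) <= eps * INR T * OPT.
Proof.
  pose proof alpha_bounds as [Ha Ha1]; pose proof w_ge_1; pose proof OPT_ge_1.
  set (Phi := fun k ts => sumn (fun l => regret (xk ts l)) k +
    potential (xk ts k) - INR k * (2 * alpha * OPT)).
  assert (SM : expect w T (Phi T) <= Phi O []).
  { apply expect_supermartingale; [apply w_pos|]; intros k ts Hk.
    rewrite (sumn_ext _ (fun t => (sumn (fun l => regret (xk ts l)) k +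
      regret (xk ts k) - INR (S k) * (2 * alpha * OPT)) + potential (step (xk ts k) t))).
    - rewrite sumn_plus, sumn_const.
      pose proof (potential_step (xk ts k) (xk_nonneg ts k) (Ax_xk ts k)) as P.
      unfold Phi; rewrite S_INR; lra.
    - intros t _; unfold Phi; subst k; rewrite xk_snoc; cbn [sumn].
      rewrite xk_app by lia.
      rewrite (sumn_ext _ (fun l => regret (xk ts l)))
        by (intros; rewrite xk_app by lia; reflexivity).
      ring. }
  set (c := INR w / alpha) in *.
  assert (Hc : 0 < c) by (apply Rdiv_lt_0_compat; lra).
  assert (I0 : Phi O [] <= c * OPT).
  { unfold Phi, potential; fold c; simpl.
    pose proof fmu_x0.
    assert (sumn x0 n <= 1 * OPT).
    { apply sum_le_OPT; [intros i Hi; left; apply x0_pos, Hi | lra|].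
      intros j Hj; pose proof (Ax_x0 j Hj); lra. }
    nra. }
  assert (IT : expect w T (fun ts => sumn (fun k => regret (xk ts k)) T) <=
    expect w T (fun ts => Phi T ts + (c * ((1 + eps) * OPT) + INR T * (2 * alpha * OPT)))).
  { apply expect_le; [apply w_pos|]; intros ts _.
    unfold Phi, potential; fold c.
    assert (S1 : sumn (xk ts T) n <= (1 + eps) * OPT)
      by (apply sum_le_OPT; [apply xk_nonneg | lra | apply Ax_xk]).
    (* As the barrier is nonnegative, [1^T x + 2 * f >= - 1^T x], which bounds the final potential
       from below. *)
    assert (S2 : - sumn (xk ts T) n <= fmu (xk ts T)).
    { unfold fmu; pose proof mu_pos.
      assert (0 <= sumn (pj (xk ts T)) m)
        by (apply sumn_nonneg; intros; left; apply pj_pos).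
      nra. }
    assert (c * sumn (xk ts T) n <= c * ((1 + eps) * OPT))
      by (apply Rmult_le_compat_l; lra).
    assert (c * - sumn (xk ts T) n <= c * fmu (xk ts T))
      by (apply Rmult_le_compat_l; lra).
    lra. }
  rewrite expect_plus, expect_const in IT by apply w_pos.
  pose proof T_ge_w_alpha as HT; fold c in HT.
  assert (Hal : alpha <= eps / 240) by (pose proof mu_le; unfold Defs.alpha; lra).
  destruct T_bounds as (_ & _ & _ & HT0).
  assert (c * (OPT + (1 + eps) * OPT) <= eps * INR T / 3 * (OPT + (1 + eps) * OPT))
    by (apply Rmult_le_compat_r; nra).
  assert (INR T * (2 * alpha * OPT) <= INR T * (2 * (eps / 240) * OPT))
    by (apply Rmult_le_compat_l; nra).
  assert (0 <= eps * INR T * OPT) by (repeat apply Rmult_le_pos; lra).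
  nra.
Qed.

(** A row with [(A x)_j >= 1 - eps] is charged to [p_j * (A x)_j]; any other row has
    [p_j <= N ^ -4]. Transposition turns the charge into [<1 + grad, x>], to which the fourth bound
    of [xi_bounds] applies. *)
Lemma sum_pj_le x : nonneg x -> (forall j, (j < m)%nat -> Ax x j <= 1 + eps) ->
  (1 - eps) * sumn (pj x) m <= (1 + 4 * eps) * OPT + regret x.
Proof.
  intros Hx HAx; pose proof OPT_ge_1; pose proof N_ge_30; pose proof mu_pos.
  assert (HN4 : 0 < N ^ 4) by (apply pow_lt; lra).
  assert (P : (1 - eps) * sumn (pj x) m <=
    sumn (fun j => pj x j * Ax x j) m + INR m * / N ^ 4).
  { rewrite <- sumn_const, <- sumn_scal, <- sumn_plus.
    apply sumn_le; intros j Hj.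
    pose proof (pj_pos x j); pose proof (Ax_nonneg x j Hx Hj).
    assert (0 < / N ^ 4) by (apply Rinv_0_lt_compat; assumption).
    destruct (Rle_or_lt (1 - eps) (Ax x j)) as [C|C]; [nra|].
    assert (pj x j <= / N ^ 4); [|nra].
    rewrite <- exp_eps_mu, <- exp_Ropp; apply exp_le_mono.
    rewrite <- Rdiv_opp_l.
    apply Rmult_le_compat_r; [left; apply Rinv_0_lt_compat|]; lra. }
  assert (Q : INR m * / N ^ 4 <= eps).
  { pose proof m_le_N_eps.
    apply Rmult_le_reg_r with (N ^ 4); [assumption|].
    rewrite Rmult_assoc, Rinv_l by lra.
    assert (1 <= N ^ 3) by (apply pow_R1_Rle; lra).
    replace (eps * N ^ 4) with (N * eps * N ^ 3) by ring.
    assert (0 < N * eps) by nra. nra. }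
  rewrite sum_pj_Ax in P.
  assert (S : sumn (fun i => (1 + grad x i) * x i) n <= (1 + eps) * sumn x n + regret x).
  { unfold regret; rewrite <- sumn_scal, <- !sumn_plus.
    apply sumn_le; intros i Hi; specialize (Hx i Hi).
    destruct (xi_bounds eps _ Heps ltac:(lra) (grad_ge x i Hi)) as (_ & _ & _ & B & _).
    set (g := grad x i) in *; nra. }
  pose proof (sum_le_OPT x (1 + eps) Hx ltac:(lra) HAx) as O.
  assert ((1 + eps) * sumn x n <= (1 + eps) * ((1 + eps) * OPT))
    by (apply Rmult_le_compat_l; lra).
  assert (0 <= eps * OPT) by nra.
  assert (eps <= eps * OPT) by nra.
  assert (eps * (eps * OPT) <= 1 / 30 * (eps * OPT)) by (apply Rmult_le_compat_r; lra).
  lra.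
Qed.

(** * The averaged dual vector *)

Local Notation ybar := (ybar m n A eps).
Local Notation lam := (lam m n A eps).

Lemma sum_ybar ts :
  INR T * sumn (ybar ts) m = sumn (fun k => sumn (pj (xk ts k)) m) T.
Proof.
  destruct T_bounds as (_ & _ & _ & HT).
  unfold Defs.ybar; rewrite sumn_scal, <- Rmult_assoc, Rinv_r, Rmult_1_l by lra.
  apply sumn_swap.
Qed.

(** As [A^T p = 1 + grad], the quantity [lam - eps] is the time average of the gradient
    coordinate. *)
Lemma lam_grad ts i :
  INR T * (lam ts i - eps) = sumn (fun k => grad (xk ts k) i) T.
Proof.
  destruct T_bounds as (_ & _ & _ & HT).
  unfold Defs.lam, Defs.grad; rewrite sumn_plus, sumn_const.
  rewrite sumn_swap.
  rewrite (sumn_ext (fun j => A j i * ybar ts j)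
    (fun j => / INR T * sumn (fun k => A j i * pj (xk ts k) j) T)).
  - rewrite sumn_scal.
    set (s := sumn (fun j => sumn _ _) _); field; lra.
  - intros j _; unfold Defs.ybar; rewrite sumn_scal; ring.
Qed.

Lemma expect_ybar :
  expect w T (fun ts => sumn (ybar ts) m) <= (1 + 7 * eps) * OPT.
Proof.
  destruct T_bounds as (_ & _ & _ & HT); pose proof OPT_ge_1.
  assert (E : expect w T (fun ts => INR T * (1 - eps) * sumn (ybar ts) m) <=
    expect w T (fun ts => INR T * ((1 + 4 * eps) * OPT) +
      sumn (fun k => regret (xk ts k)) T)).
  { apply expect_le; [apply w_pos|]; intros ts _.
    rewrite (Rmult_comm (INR T)), Rmult_assoc, sum_ybar.
    rewrite <- sumn_const, <- sumn_plus, <- sumn_scal; apply sumn_le; intros k _.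
    apply sum_pj_le; [apply xk_nonneg | apply Ax_xk]. }
  rewrite expect_scal, expect_plus, expect_const in E by apply w_pos.
  pose proof expect_regret as R.
  set (e := expect w T (fun ts => sumn (ybar ts) m)) in *.
  assert (F : (1 - eps) * e <= (1 + 5 * eps) * OPT)
    by (apply Rmult_le_reg_l with (INR T); lra).
  apply Rmult_le_reg_l with (1 - eps); [lra|].
  (* This is [(1 - eps) * (1 + 7 * eps) >= 1 + 5 * eps], valid for [eps <= 1 / 7]. *)
  assert (0 <= eps * OPT * (1 / 7 - eps)) by (repeat apply Rmult_le_pos; lra).
  lra.
Qed.

(** * Corrections of Algorithm 2 *)

Lemma xk_closed_form ts k i :
  xk ts k i = x0 i *
    exp (- alpha * sumn (fun l => xi_t (nth l ts O) (xi (grad (xk ts l) i))) k).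
Proof.
  induction k as [|k IH]; cbn [sumn].
  - rewrite Rmult_0_r, exp_0; simpl; ring.
  - rewrite Rmult_plus_distr_l, exp_plus, <- Rmult_assoc, <- IH; reflexivity.
Qed.

(** The coordinate starts at [(1 - eps / 2) / (n * colmax)] and never exceeds [(1 + eps) / colmax],
    so its total growth factor [exp (- alpha * s)] is at most [2 * n]. *)
Lemma sum_xi_t_ge ts k i : (i < n)%nat ->
  - ln (2 * INR n) <=
  alpha * sumn (fun l => xi_t (nth l ts O) (xi (grad (xk ts l) i))) k.
Proof.
  intros Hi; set (s := sumn _ _).
  pose proof (coord_le (xk ts k) (1 + eps) i (xk_nonneg ts k) (Ax_xk ts k) Hi) as C.
  rewrite xk_closed_form, <- Rmult_assoc, x0_colmax in C by assumption; fold s in C.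
  pose proof n_ge_1; pose proof (exp_pos (- alpha * s)).
  assert (E : exp (- alpha * s) <= 2 * INR n).
  { assert (C' : (1 - eps / 2) * exp (- alpha * s) <= (1 + eps) * INR n).
    { apply Rmult_le_reg_l with (/ INR n); [apply Rinv_0_lt_compat; lra|].
      replace (/ INR n * ((1 + eps) * INR n)) with (1 + eps) by (field; lra).
      unfold Rdiv in C; lra. }
    nra. }
  apply ln_le_mono in E; [|assumption].
  rewrite ln_exp in E; lra.
Qed.

(* Exponential supermartingale controlling the deviation of the sampled
   truncated gradients of coordinate [i] from their conditional means. *)
Definition expmart (i k : nat) (ts : list nat) : R :=
  exp (sumn (fun l => eps * xi_t (nth l ts O) (xi (grad (xk ts l) i)) -
                      eps / INR w * xi (grad (xk ts l) i) - eps ^ 2 / INR w) k).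

(** Given the past, the mean of [exp (eps * xi_t)] is [1 + (exp (eps * v) - 1) / w], which is at
    most [1 + (eps * v + eps ^ 2) / w = 1 + r <= exp r]; each step divides by [exp r]. *)
Lemma expect_expmart i : (i < n)%nat -> expect w T (expmart i T) <= 1.
Proof.
  intros Hi; pose proof w_ge_1 as Hw.
  replace 1 with (expmart i O []) by (unfold expmart; simpl; apply exp_0).
  apply expect_supermartingale; [apply w_pos|]; intros k ts Hk.
  set (v := xi (grad (xk ts k) i)).
  set (r := eps / INR w * v + eps ^ 2 / INR w).
  rewrite (sumn_ext _ (fun t => expmart i k ts * exp (- r) * exp (eps * xi_t t v))).
  - rewrite sumn_scal.
    (* Subtracting 1 makes the summand vanish at 0, as [sumn_bucket] requires. *)
    rewrite (sumn_ext _ (fun t => (exp (eps * xi_t t v) - 1) + 1)) by (intros; ring).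
    unfold v at 1; rewrite sumn_plus, sumn_const, (sumn_bucket (fun u => exp (eps * u) - 1));
      [|apply grad_ge, Hi | rewrite Rmult_0_r, exp_0; ring]; fold v.
    destruct (xi_bounds eps _ Heps ltac:(lra) (grad_ge (xk ts k) i Hi)) as (B & _).
    fold v in B.
    assert (Hv : Rabs (eps * v) <= 1 / 4).
    { rewrite Rabs_mult, (Rabs_right eps) by lra; pose proof (Rabs_pos v); nra. }
    pose proof (exp_le_quadratic (eps * v) Hv) as E.
    assert (V2 : v ^ 2 <= 1)
      by (rewrite <- pow2_abs; pose proof (Rabs_pos v); nra).
    assert (F : exp (eps * v) - 1 + INR w * 1 <= INR w * exp r).
    { apply Rle_trans with (INR w * (1 + r)).
      - replace (INR w * (1 + r)) with (INR w + eps * v + eps ^ 2)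
          by (unfold r; field; lra).
        assert (0 <= eps ^ 2) by (apply pow_le; lra).
        replace ((eps * v) ^ 2) with (eps ^ 2 * v ^ 2) in E by ring. nra.
      - apply Rmult_le_compat_l; [lra | apply exp_ineq1_le]. }
    apply Rle_trans with (expmart i k ts * exp (- r) * (INR w * exp r)).
    + apply Rmult_le_compat_l; [|exact F].
      left; apply Rmult_lt_0_compat; apply exp_pos.
    + right; rewrite exp_Ropp; field; apply Rgt_not_eq, exp_pos.
  - intros t _; subst k; unfold expmart; cbn [sumn].
    rewrite <- !exp_plus, xk_app, nth_middle by lia; fold v; f_equal.
    rewrite (sumn_ext _ (fun l => eps * xi_t (nth l ts O) (xi (grad (xk ts l) i)) -
      eps / INR w * xi (grad (xk ts l) i) - eps ^ 2 / INR w))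
      by (intros; rewrite xk_app, app_nth1 by lia; reflexivity).
    unfold r; ring.
Qed.

(** A coordinate in need of correction has very negative conditional means, while its samples are
    bounded below, so the exponential reaches [n / eps]. In the scaled form it dominates the
    indicator of a correction. *)
Lemma expmart_ge ts i : (i < n)%nat -> lam ts i <= -2 * eps ->
  1 <= eps / INR n * expmart i T ts.
Proof.
  intros Hi Hlam; pose proof w_ge_1 as Hw; pose proof n_ge_1.
  destruct T_bounds as (_ & _ & _ & HT).
  pose proof ln_n_eps_bounds as [Hln _].
  assert (E : ln (INR n / eps) <= ln (expmart i T ts)).
  { unfold expmart; rewrite ln_exp.
    rewrite (sumn_ext _ (fun l => eps * xi_t (nth l ts O) (xi (grad (xk ts l) i)) +
      ((- (eps / INR w)) * xi (grad (xk ts l) i) + - (eps ^ 2 / INR w))))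
      by (intros; ring).
    rewrite !sumn_plus, !sumn_scal, sumn_const.
    pose proof (sum_xi_t_ge ts T i Hi) as U.
    set (u := sumn (fun l => xi_t (nth l ts O) (xi (grad (xk ts l) i))) T) in *.
    (* The truncation error [eps] per step cancels the shift by [eps] in [lam]. *)
    assert (X : sumn (fun l => xi (grad (xk ts l) i)) T <= -2 * eps * INR T).
    { apply Rle_trans with (INR T * (lam ts i - eps) + INR T * eps).
      - rewrite lam_grad, <- sumn_const, <- sumn_plus; apply sumn_le; intros k _.
        destruct (xi_bounds eps _ Heps ltac:(lra) (grad_ge (xk ts k) i Hi)) as (_ & B & _).
        lra.
      - nra. }
    set (s := sumn (fun l => xi (grad (xk ts l) i)) T) in *.
    pose proof T_ge_ln_2n as T1; pose proof T_ge_ln_n_eps as T2.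
    pose proof alpha_bounds as [Ha _].
    assert (U' : - (eps * INR T / 6) <= INR w * u).
    { assert (INR w / alpha * (- ln (2 * INR n)) <= INR w / alpha * (alpha * u)).
      { apply Rmult_le_compat_l; [|exact U].
        left; apply Rdiv_lt_0_compat; lra. }
      replace (INR w / alpha * (alpha * u)) with (INR w * u) in * by (field; lra).
      lra. }
    apply Rmult_le_reg_l with (INR w); [lra|].
    replace (INR w * (eps * u + (- (eps / INR w) * s + INR T * - (eps ^ 2 / INR w))))
      with (eps * (INR w * u) + - eps * s - eps ^ 2 * INR T) by (field; lra).
    (* In units of [eps ^ 2 * T], the samples, the means and the normalisation contribute at least
       -1/6, 2 and -1; the total exceeds the 1/2 that [T2] asks for. *)
    assert (eps * - (eps * INR T / 6) <= eps * (INR w * u))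
      by (apply Rmult_le_compat_l; lra).
    assert (eps * (2 * eps * INR T) <= eps * - s)
      by (apply Rmult_le_compat_l; lra).
    assert (INR w * ln (INR n / eps) <= INR w ^ 2 * ln (INR n / eps))
      by (apply Rmult_le_compat_r; nra).
    assert (0 <= INR w * ln (INR n / eps)) by (apply Rmult_le_pos; lra).
    nra. }
  assert (Hne : 0 < INR n / eps) by (apply Rdiv_lt_0_compat; lra).
  assert (E' : INR n / eps <= expmart i T ts).
  { rewrite <- (exp_ln (INR n / eps)) by assumption.
    unfold expmart in *; rewrite ln_exp in E; apply exp_le_mono, E. }
  replace 1 with (eps / INR n * (INR n / eps)) by (field; lra).
  apply Rmult_le_compat_l; [|exact E'].
  left; apply Rdiv_lt_0_compat; lra.
Qed.

Lemma ybar_nonneg ts j : 0 <= ybar ts j.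
Proof.
  destruct T_bounds as (_ & _ & _ & HT).
  apply Rmult_le_pos; [left; apply Rinv_0_lt_compat, HT|].
  apply sumn_nonneg; intros; left; apply pj_pos.
Qed.

Lemma lam_ge ts i : (i < n)%nat -> eps - 1 <= lam ts i.
Proof.
  intros Hi; unfold Defs.lam.
  assert (0 <= sumn (fun j => A j i * ybar ts j) m); [|lra].
  apply sumn_nonneg; intros; apply Rmult_le_pos; [auto | apply ybar_nonneg].
Qed.

Local Notation ybar' := (ybar' m n A eps sel).
Local Notation y_out := (y_out m n A eps sel).

Lemma correction_nonneg ts j i : (i < n)%nat ->
  0 <= if Rle_dec (lam ts i) (-2 * eps) then
         (if Nat.eq_dec (sel i) j then - lam ts i / A j i else 0) else 0.
Proof.
  intros Hi; destruct (Rle_dec _ _); [|lra].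
  destruct (Nat.eq_dec (sel i) j) as [<-|]; [|lra].
  destruct (Hsel i Hi) as [_ ->]; pose proof (Hcol i Hi).
  left; apply Rdiv_lt_0_compat; lra.
Qed.

Lemma ybar'_ge ts j : ybar ts j <= ybar' ts j.
Proof.
  unfold Defs.ybar'.
  match goal with |- _ <= _ + ?s => assert (0 <= s); [|lra] end.
  apply sumn_nonneg; intros i Hi; apply correction_nonneg, Hi.
Qed.

(** Without a correction, [lam > -2 * eps] suffices. With one, the increase at the selected row
    lifts the value to at least [1 - eps], the other corrections being nonnegative. *)
Lemma ybar'_covers ts i : (i < n)%nat ->
  1 - 3 * eps <= sumn (fun j => A j i * ybar' ts j) m.
Proof.
  intros Hi.
  destruct (Rle_dec (lam ts i) (-2 * eps)) as [C|C].
  - destruct (Hsel i Hi) as [Hj Hs]; pose proof (Hcol i Hi).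
    apply Rle_trans with (sumn (fun j => A j i * ybar ts j +
      (if Nat.eq_dec (sel i) j then - lam ts i else 0)) m).
    + rewrite sumn_plus, sumn_indicator by assumption; unfold Defs.lam; lra.
    + apply sumn_le; intros j Hj'; unfold Defs.ybar'.
      rewrite Rmult_plus_distr_l; apply Rplus_le_compat_l.
      match goal with |- _ <= _ * sumn ?F n =>
        pose proof (sumn_term_le F n i (correction_nonneg ts j) Hi) as P end.
      cbv beta in P; destruct (Rle_dec (lam ts i) (-2 * eps)) in P; [|lra].
      apply Rle_trans with (A j i * (if Nat.eq_dec (sel i) j then - lam ts i / A j i else 0)).
      * destruct (Nat.eq_dec (sel i) j) as [<-|]; [|lra].
        right; field; lra.
      * apply Rmult_le_compat_l; [auto | exact P].
  - apply Rle_trans with (sumn (fun j => A j i * ybar ts j) m).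
    + unfold Defs.lam in C; lra.
    + apply sumn_le; intros j Hj; apply Rmult_le_compat_l; [auto | apply ybar'_ge].
Qed.

(** A correction costs [- lam / colmax <= 1], because [lam >= eps - 1], and [expmart_ge] dominates
    this 1 by the exponential term. *)
Lemma sum_ybar'_le ts :
  sumn (ybar' ts) m <= sumn (ybar ts) m + sumn (fun i => eps / INR n * expmart i T ts) n.
Proof.
  unfold Defs.ybar'; rewrite sumn_plus, sumn_swap.
  apply Rplus_le_compat_l, sumn_le; intros i Hi.
  destruct (Hsel i Hi) as [Hj Hs]; pose proof (Hcol i Hi).
  pose proof n_ge_1.
  destruct (Rle_dec (lam ts i) (-2 * eps)) as [C|C].
  - rewrite (sumn_ext _ (fun j =>
      if Nat.eq_dec (sel i) j then - lam ts i / colmax m A i else 0)).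
    + rewrite sumn_indicator by assumption.
      apply Rle_trans with 1; [|apply expmart_ge; assumption].
      pose proof (lam_ge ts i Hi).
      apply Rmult_le_reg_r with (colmax m A i); [lra|].
      unfold Rdiv; rewrite Rmult_assoc, Rinv_l; lra.
    + intros j _; destruct (Nat.eq_dec (sel i) j) as [<-|]; [rewrite Hs|]; reflexivity.
  - rewrite sumn_const.
    assert (0 <= eps / INR n * expmart i T ts); [|lra].
    left; apply Rmult_lt_0_compat; [apply Rdiv_lt_0_compat; lra | apply exp_pos].
Qed.

(** * The output vector *)

Lemma y_out_nonneg ts j : 0 <= y_out ts j.
Proof.
  pose proof (ybar_nonneg ts j); pose proof (ybar'_ge ts j).
  apply Rmult_le_pos; [lra | left; apply Rinv_0_lt_compat; lra].
Qed.

Lemma y_out_covers ts i : (i < n)%nat -> 1 <= sumn (fun j => A j i * y_out ts j) m.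
Proof.
  intros Hi; pose proof (ybar'_covers ts i Hi) as C.
  rewrite (sumn_ext _ (fun j => / (1 - 3 * eps) * (A j i * ybar' ts j)))
    by (intros; unfold Defs.y_out; field; lra).
  rewrite sumn_scal; apply Rmult_le_reg_l with (1 - 3 * eps); [lra|].
  rewrite <- Rmult_assoc, Rinv_r; lra.
Qed.

Lemma expect_y_out :
  expect w T (fun ts => sumn (y_out ts) m) <= (1 + 20 * eps) * OPT.
Proof.
  pose proof OPT_ge_1; pose proof n_ge_1; pose proof expect_ybar as Y.
  assert (E : expect w T (fun ts => sumn (y_out ts) m) <=
    expect w T (fun ts => / (1 - 3 * eps) * (sumn (ybar ts) m +
      sumn (fun i => eps / INR n * expmart i T ts) n))).
  { apply expect_le; [apply w_pos|]; intros ts _.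
    rewrite (sumn_ext _ (fun j => / (1 - 3 * eps) * ybar' ts j))
      by (intros; unfold Defs.y_out; field; lra).
    rewrite sumn_scal; apply Rmult_le_compat_l; [|apply sum_ybar'_le].
    left; apply Rinv_0_lt_compat; lra. }
  rewrite expect_scal, expect_plus in E.
  assert (F : expect w T (fun ts => sumn (fun i => eps / INR n * expmart i T ts) n) <= eps).
  { rewrite expect_sumn.
    apply Rle_trans with (sumn (fun _ => eps / INR n * 1) n);
      [|rewrite sumn_const; right; field; lra].
    apply sumn_le; intros i Hi; rewrite expect_scal.
    apply Rmult_le_compat_l; [left; apply Rdiv_lt_0_compat; lra|].
    apply expect_expmart, Hi. }
  eapply Rle_trans; [exact E|].
  apply Rmult_le_reg_l with (1 - 3 * eps); [lra|].
  rewrite <- Rmult_assoc, Rinv_r, Rmult_1_l by lra.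
  (* This is [(1 - 3 * eps) * (1 + 20 * eps) >= 1 + 8 * eps]; the 8 is 7 from [expect_ybar] plus 1
     from the corrections, as [eps <= eps * OPT]. *)
  assert (0 <= eps * OPT * (9 / 60 - eps)) by (repeat apply Rmult_le_pos; lra).
  assert (eps <= eps * OPT) by nra.
  lra.
Qed.

(** The nonnegative excess [1^T y - OPT] has mean at most [20 * eps * OPT], so it passes ten times
    that value with probability at most 1/10. *)
Lemma y_out_near_optimal :
  prob_seq w T
    (fun ts => if Rle_dec (sumn (y_out ts) m) ((1 + 200 * eps) * OPT)
               then true else false) >= 9 / 10.
Proof.
  pose proof OPT_ge_1.
  replace (9 / 10) with (1 - 1 / 10) by field.
  apply (expect_markov _ _ (fun ts => sumn (y_out ts) m) OPT); [apply w_pos | nra | |].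
  - intros ts _; rewrite <- (Rmult_1_l OPT).
    apply weak_duality; [intros; apply y_out_nonneg | apply y_out_covers | lra].
  - pose proof expect_y_out; lra.
Qed.

End Algorithm.

Theorem theorem2 :
  exists C D : R, 0 < C /\ 0 < D /\
  forall (m n : nat) (A : nat -> nat -> R) (eps OPT : R) (sel : nat -> nat),
    (0 < m)%nat -> (0 < n)%nat ->
    (forall j i, (j < m)%nat -> (i < n)%nat -> 0 <= A j i) ->
    (forall i, (i < n)%nat -> exists j, (j < m)%nat /\ A j i <> 0) ->
    (forall i, (i < n)%nat -> 1 <= colmax m A i) ->
    (exists i, (i < n)%nat /\ colmax m A i = 1) ->
    0 < eps -> eps <= 1 / 30 ->
    is_lub (packing_values m n A) OPT ->
    (forall i, (i < n)%nat -> (sel i < m)%nat /\ A (sel i) i = colmax m A i) ->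
    let w := wpar eps in
    let T := Tpar m n eps in
    let y := y_out m n A eps sel in
    (* y >= 0 and A^T y >= 1 for every outcome of the random choices *)
    (forall ts, In ts (all_seqs w T) ->
       (forall j, (j < m)%nat -> 0 <= y ts j) /\
       (forall i, (i < n)%nat -> sumn (fun j => A j i * y ts j) m >= 1)) /\
    (* with probability at least 9/10, 1^T y <= (1 + C eps) OPT *)
    prob_seq w T
      (fun ts => if Rle_dec (sumn (y ts) m) ((1 + C * eps) * OPT)
                 then true else false) >= 9 / 10 /\
    (* iteration count *)
    INR T <= D * (ln (1 / eps) ^ 2 * ln (INR n * INR m / eps) * ln (2 * INR n)
                  / eps ^ 2).

Proof.
  exists 200, 1000; split; [lra|]; split; [lra|].
  intros m n A eps OPT sel Hm Hn HA _ Hcol Hone Heps Heps30 HOPT Hsel w T y.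
  split; [|split].
  - intros ts _; split.
    + intros j _; apply y_out_nonneg; assumption.
    + intros i Hi; apply Rle_ge, y_out_covers; assumption.
  - apply y_out_near_optimal; assumption.
  - apply T_upper; assumption.
Qed.
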